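(* Let $\Gamma$ be a tight distance-regular graph with classical parameters $(D,b,\alpha,\beta)$, where $D\geq 3$ and $b\geq 2$. Then for every vertex $x$ of $\Gamma$, the local graph of $\Gamma$ at $x$ is neither the block graph of an orthogonal array nor the block graph of a Steiner system.
   Context: Graphs are finite, undirected, connected and simple; $\partial$ is the path-length distance, $\Gamma_i(x)=\{y:\partial(x,y)=i\}$, $\Gamma(x)=\Gamma_1(x)$. A connected graph $\Gamma$ with diameter $D$ is distance-regular if for all $0\le h,i,j\le D$ and all vertices $x,y$ with $\partial(x,y)=h$ the number $p^h_{i,j}=|\Gamma_i(x)\cap\Gamma_j(y)|$ depends only on $h,i,j$; write $c_i=p^i_{1,i-1}$, $a_i=p^i_{1,i}$, $b_i=p^i_{1,i+1}$ and $k=b_0$ (the valency). Such a graph has exactly $D+1$ distinct (adjacency) eigenvalues $k=\theta_0>\theta_1>\cdots>\theta_D$. A distance-regular graph with $D\ge 3$ is tight if it is nonbipartite and $$\left(\theta_1+\frac{k}{a_1+1}\right)\left(\theta_D+\frac{k}{a_1+1}\right)=-\frac{k a_1 b_1}{(a_1+1)^2}.$$ For a non-zero integer $b$ put $\left[{i\atop 1}\right]=1+b+b^2+\cdots+b^{i-1}$. A distance-regular graph with diameter $D\ge 3$ has classical parameters $(D,b,\alpha,\beta)$ if $$b_i=\left(\left[{D\atop 1}\right]-\left[{i\atop 1}\right]\right)\left(\beta-\alpha\left[{i\atop 1}\right]\right)\ (0\le i\le D-1),\qquad c_i=\left[{i\atop 1}\right]\left(1+\alpha\left[{i-1\atop 1}\right]\right)\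 (1\le i\le D).$$ The local graph of $\Gamma$ at a vertex $x$ is the subgraph induced on $\Gamma(x)$. An orthogonal array $\operatorname{OA}(p,q)$ is a $p\times q^2$ array with entries in $\{1,\ldots,q\}$ such that the columns of every $2\times q^2$ subarray (formed by two rows) contain each of the $q^2$ ordered pairs exactly once. Its block graph has the columns as vertices, two distinct columns being adjacent if and only if there is a row in which they have the same entry. A Steiner system $S(2,p,q)$ is a $2$-$(q,p,1)$ design: a collection of $p$-subsets (blocks) of a $q$-set (of points) such that every pair of distinct points is contained in exactly one block. Its block graph has the blocks as vertices, two blocks being adjacent if and only if they intersect in exactly one point. *)

(* Defs.v *)
From mathcomp Require Import all_boot all_order all_algebra.
Set Implicit Arguments.
Unset Strict Implicit.
Unset Printing Implicit Defensive.
Import Order.TTheory GRing.Theory Num.Theory.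
Local Open Scope ring_scope.

Definition simple_graph (T : finType) (e : rel T) : Prop :=
  symmetric e /\ irreflexive e.

Definition connected_graph (T : finType) (e : rel T) : Prop :=
  forall x y : T, connect e x y.

(* Some walk with exactly n edges goes from x to y. *)
Definition walk (T : finType) (e : rel T) (n : nat) (x y : T) : bool :=
  [exists p : n.-tuple T, path e x p && (last x p == y)].

(* The least length of a walk from x to y. A shortest walk has fewer than #|T|
   edges, so the bounded search is exhaustive; the value is #|T| when y is not
   reachable from x. *)
Definition dist (T : finType) (e : rel T) (x y : T) : nat :=
  find (fun n => walk e n x y) (iota 0 #|T|).

Definition diameter (T : finType) (e : rel T) : nat :=
  \max_(x : T) \max_(y : T) dist e x y.

Definition sphere (T : finType) (e : rel T) (i : nat) (x : T) : {set T} :=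
  [set y | dist e x y == i].

(* p^h_{i,j}, read off from an arbitrary pair of vertices at distance h. The
   choice of pair is immaterial in a distance-regular graph. *)
Definition intersection_number (T : finType) (e : rel T) (h i j : nat) : nat :=
  if [pick u : T * T | dist e u.1 u.2 == h] is Some u
  then #|sphere e i u.1 :&: sphere e j u.2| else 0%N.

Definition distance_regular (T : finType) (e : rel T) : Prop :=
  [/\ simple_graph e,
      connected_graph e
    & forall h i j : nat,
        (h <= diameter e)%N -> (i <= diameter e)%N -> (j <= diameter e)%N ->
      forall x y : T, dist e x y = h ->
        #|sphere e i x :&: sphere e j y| = intersection_number e h i j].

(* Only used for i >= 1. *)
Definition drg_c (T : finType) (e : rel T) (i : nat) : nat :=
  intersection_number e i 1 i.-1.
Definition drg_a (T : finType) (e : rel T) (i : nat) : nat :=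
  intersection_number e i 1 i.
Definition drg_b (T : finType) (e : rel T) (i : nat) : nat :=
  intersection_number e i 1 i.+1.
Definition valency (T : finType) (e : rel T) : nat := drg_b e 0.

Definition bipartite (T : finType) (e : rel T) : Prop :=
  exists f : T -> bool, forall x y : T, e x y -> f x != f y.

Definition adjacency_matrix (R : nzRingType) (T : finType) (e : rel T) :
    'M[R]_#|T| :=
  \matrix_(i, j) (e (enum_val i) (enum_val j))%:R.

(* theta lists the distinct eigenvalues in R of the graph, in strictly
   decreasing order. As R is real closed and the matrix symmetric, these are
   all of its eigenvalues. *)
Definition spectrum (R : rcfType) (T : finType) (e : rel T) (theta : seq R) :
    Prop :=
  sorted (fun t u : R => u < t) theta /\
  forall t : R, (t \in theta) = eigenvalue (adjacency_matrix R e) t.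

Definition tight (R : rcfType) (T : finType) (e : rel T) : Prop :=
  let D := diameter e in
  let k : R := (valency e)%:R in
  let a1 : R := (drg_a e 1)%:R in
  let b1 : R := (drg_b e 1)%:R in
  [/\ distance_regular e, (3 <= D)%N, ~ bipartite e
    & exists theta : seq R, spectrum e theta /\
      (theta`_1 + k / (a1 + 1)) * (theta`_D + k / (a1 + 1))
        = - ((k * a1 * b1) / (a1 + 1) ^+ 2)].

(* [i over 1] = 1 + b + ... + b^(i-1) *)
Definition qnum (R : nzRingType) (b : int) (i : nat) : R :=
  \sum_(j < i) b%:~R ^+ j.

Definition classical_parameters (R : rcfType) (T : finType) (e : rel T)
    (D : nat) (b : int) (alpha beta : R) : Prop :=
  [/\ distance_regular e, diameter e = D /\ (3 <= D)%N, b != 0,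
      forall i : nat, (i <= D.-1)%N ->
        (drg_b e i)%:R
          = (qnum R b D - qnum R b i) * (beta - alpha * qnum R b i)
    & forall i : nat, (1 <= i <= D)%N ->
        (drg_c e i)%:R = qnum R b i * (1 + alpha * qnum R b i.-1)].

Definition local_graph (T : finType) (e : rel T) (x : T) :
    rel {y : T | e x y} :=
  fun y z => e (val y) (val z).
Arguments local_graph {T} e x.

Definition isomorphic (T U : finType) (e : rel T) (f : rel U) : Prop :=
  exists g : T -> U, bijective g /\ forall x y : T, f (g x) (g y) = e x y.

(* The q symbols are represented by 'I_q. *)
Definition orthogonal_array (p q : nat) (A : 'M['I_q]_(p, q ^ 2)) : Prop :=
  forall r s : 'I_p, r != s ->
  forall u v : 'I_q, #|[set c | (A r c == u) && (A s c == v)]| = 1%N.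

Definition oa_block_graph (p q : nat) (A : 'M['I_q]_(p, q ^ 2)) :
    rel 'I_(q ^ 2) :=
  fun c d => (c != d) && [exists r : 'I_p, A r c == A r d].

Definition steiner_system (p q : nat) (B : {set {set 'I_q}}) : Prop :=
  (forall X : {set 'I_q}, X \in B -> #|X| = p) /\
  (forall u v : 'I_q, u != v ->
     #|[set X in B | (u \in X) && (v \in X)]| = 1%N).

Definition steiner_block_graph (q : nat) (B : {set {set 'I_q}}) :
    rel {X : {set 'I_q} | X \in B} :=
  fun X Y => (X != Y) && (#|val X :&: val Y| == 1%N).
Arguments steiner_block_graph {q} B.

Definition is_oa_block_graph (T : finType) (e : rel T) : Prop :=
  exists (p q : nat) (A : 'M['I_q]_(p, q ^ 2)),
    orthogonal_array A /\ isomorphic e (oa_block_graph A).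

Definition is_steiner_block_graph (T : finType) (e : rel T) : Prop :=
  exists (p q : nat) (B : {set {set 'I_q}}),
    steiner_system p B /\ isomorphic e (steiner_block_graph B).

(* Main.v *)
Require Import Defs.
From mathcomp Require Import all_boot all_order all_algebra.
From mathcomp Require Import zify ring lra.
Import Order.TTheory GRing.Theory Num.Theory.
Local Open Scope ring_scope.

(** Write [n = 1 + b + ... + b ^ (D - 2)].  The eigenvalues of a graph with
    classical parameters and [b >= 2] are explicit ([spectrum_classical]), and
    with their values tightness becomes [beta = 1 + alpha n] with [alpha > 0]
    ([tight_beta], [tight_alpha_gt0]).  Each eigenvalue has a positive
    semidefinite matrix whose entries depend on the distance only
    ([distance_eigenfunction_form]).  For the least eigenvalue this bounds cliques
    by [1 + beta] vertices, and shows that a vertex with a neighbour in a clique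
    of that size, but outside the clique, has exactly [1 + alpha] neighbours
    there ([clique_card_le], [maximal_clique_nbrs]).  For the second largest it
    bounds the eigenvalues of local graphs below by [- 1 - b] on vectors with sum
    zero ([local_form_ge0]).

    The two kinds of block graphs are collinearity graphs of partial geometries,
    with [p] lines on a point, [l] points on a line and [tau] neighbours of a
    point on a line off it, where [tau] is [p - 1] for an orthogonal array and
    [p] for a Steiner system.  If such a graph is the local graph at [x], then
    a line and [x] form a clique, so [l <= beta]; and [- p] is a local eigenvalue,
    so [p <= 1 + b].  As [p (l - 1) = a_1 = (1 + b) alpha n], both bounds are
    attained, and counting points gives [tau = alpha]
    ([local_geometry_parameters]).

    Now a vertex [z] at distance two from [x] has
    [c_2 = (1 + b) (1 + alpha) = p (tau + 1)] common neighbours with [x], and by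
    [maximal_clique_nbrs] they meet each line in 0 or [tau + 1] points.  Double
    counting shows that they are a subgeometry in which nonadjacent points have
    the same neighbours ([pg_sub_closed], [pg_sub_nonadjacent]).  Two nonadjacent
    points of the local graph always lie in such a subgeometry; letting one of
    them run along a line, one finds a point with more than [tau] neighbours on
    that line unless [l < 2 tau] ([pg_no_subgeometries]).  But
    [l = 1 + tau n >= 2 tau].

    The degenerate designs, with [p <= 1], give disjoint unions of cliques, which
    have cliques that are too large ([local_not_cluster]). *)

Set Implicit Arguments.
Unset Strict Implicit.
Unset Printing Implicit Defensive.

(** * Path-length distance *)

Section Distance.
Variables (T : finType) (e : rel T).
Hypotheses (esym : symmetric e) (eirr : irreflexive e).
Hypothesis econ : connected_graph e.
Implicit Types x y z : T.

Lemma walkP n x y :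
  reflect (exists p, [/\ size p = n, path e x p & last x p = y]) (walk e n x y).
Proof.
apply: (iffP existsP) => [[p /andP[pp /eqP lp]]|[p [sp pp lp]]].
  by exists p; rewrite size_tuple.
by exists (tcast sp (in_tuple p)); rewrite val_tcast pp lp eqxx.
Qed.

Lemma walk_lt_card x y : has (fun n => walk e n x y) (iota 0 #|T|).
Proof.
have /connectP[p pp ->] := econ x y.
case/shortenP: pp => q pq uq _.
apply/hasP; exists (size q); last by apply/walkP; exists q.
by rewrite mem_iota add0n /=; have := max_card [in x :: q]; rewrite (card_uniqP uq).
Qed.

Lemma walk_dist x y : walk e (dist e x y) x y.
Proof.
have h := walk_lt_card x y; have := nth_find 0%N h.
by rewrite nth_iota ?add0n //; move: h; rewrite has_find size_iota.
Qed.

Lemma dist_min n x y : walk e n x y -> (dist e x y <= n)%N.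
Proof.
move=> wn; rewrite leqNgt; apply/negP => ltn.
have := before_find 0%N ltn; rewrite nth_iota ?add0n ?wn //.
by apply: leq_trans ltn _; rewrite -[leqRHS](size_iota 0) find_size.
Qed.

Lemma distxx x : dist e x x = 0%N.
Proof. by apply/eqP; rewrite -leqn0; apply/dist_min/walkP; exists [::]. Qed.

Lemma dist_eq0 x y : (dist e x y == 0%N) = (x == y).
Proof.
apply/eqP/eqP => [d0|->]; last exact: distxx.
by have /walkP[p [/eqP]] := walk_dist x y; rewrite d0 size_eq0 => /eqP -> _.
Qed.

Lemma dist_step x y z : e y z -> (dist e x z <= (dist e x y).+1)%N.
Proof.
move=> eyz; have /walkP[p [sp pp lp]] := walk_dist x y.
apply/dist_min/walkP; exists (rcons p z).
by rewrite size_rcons sp rcons_path pp lp last_rcons.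
Qed.

Lemma distC x y : dist e x y = dist e y x.
Proof.
suff le a c : (dist e a c <= dist e c a)%N by apply/eqP; rewrite eqn_leq !le.
have /walkP[p [sp pp lp]] := walk_dist c a.
apply/dist_min/walkP; exists (rev (belast c p)); split.
- by rewrite size_rev size_belast.
- by rewrite -lp rev_path; under eq_path => u v do rewrite esym.
by case: p {sp pp} lp => [|u p] //= <-; rewrite rev_cons last_rcons.
Qed.

Lemma dist_pred h x y : dist e x y = h.+1 ->
  exists2 z, e z y & dist e x z = h.
Proof.
move=> dh; have /walkP[p [sp pp lp]] := walk_dist x y.
case/lastP: p sp pp lp => [|p u]; first by rewrite dh.
rewrite size_rcons dh => -[sp]; rewrite rcons_path last_rcons => /andP[pp eu] uy.
subst y; exists (last x p) => //.
apply/eqP; rewrite eqn_leq; apply/andP; split; last first.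
  by rewrite -ltnS -dh; apply: dist_step.
by apply/dist_min/walkP; exists p.
Qed.

Lemma dist_eq1 x y : (dist e x y == 1%N) = e x y.
Proof.
apply/eqP/idP => [/dist_pred[z ezy /eqP]|exy].
  by rewrite dist_eq0 => /eqP ->.
have: (dist e x y <= 1)%N by rewrite -(distxx x); apply: dist_step.
have: dist e x y != 0%N.
  by rewrite dist_eq0; apply: contraTneq exy => ->; rewrite eirr.
by case: (dist e x y) => [|[|]].
Qed.

Lemma dist_eq2 x y z : e x y -> e x z -> y != z -> ~~ e y z -> dist e y z = 2.
Proof.
move=> exy exz yz nyz.
have := dist_step y exz.
have /eqP -> : dist e y x == 1%N by rewrite dist_eq1 // esym.
have : dist e y z != 0%N by rewrite dist_eq0.
have : dist e y z != 1%N by rewrite dist_eq1.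
by case: (dist e y z) => [|[|[|]]].
Qed.

Lemma dist_le_diameter x y : (dist e x y <= diameter e)%N.
Proof.
apply: leq_trans (leq_bigmax (F := fun y => dist e x y) y) _.
exact: (leq_bigmax (F := fun x => \max_(y : T) dist e x y) x).
Qed.

Lemma dist_step_cases x y z : e y z ->
  [\/ dist e x z = (dist e x y).-1 /\ (0 < dist e x y)%N, dist e x z = dist e x y
    | dist e x z = (dist e x y).+1].
Proof.
move=> eyz; have := dist_step x eyz; have := dist_step x (etrans (esym z y) eyz).
set a := dist e x y; set c := dist e x z => h1 h2.
have [lt|gt|eq] := ltngtP c a.
- by apply: Or31; lia.
- by apply: Or33; lia.
by apply: Or32.
Qed.

Lemma exists_dist h : (0 < #|T|)%N -> (h <= diameter e)%N ->
  exists x, exists y, dist e x y = h.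
Proof.
case/card_gt0P => x0 _.
have T0 : (0 < #|T|)%N by apply/card_gt0P; exists x0.
have [x dx] := @bigop.eq_bigmax T (fun x => \max_(y : T) dist e x y) T0.
have [y dy] := @bigop.eq_bigmax T (dist e x) T0.
rewrite /diameter dx.
rewrite dy => hle; exists x.
elim: (dist e x y - h)%N {-2}y (erefl (dist e x y - h)%N) hle => [|n IH] z.
  by move=> d0 hle; exists z; lia.
move=> dz hle; have [u _ du] : exists2 u, e u z & dist e x u = (dist e x z).-1.
  by apply: dist_pred; lia.
by apply: (IH u); lia.
Qed.

End Distance.

(** * Distance-regular graphs: distance eigenfunctions and positivity *)

(** For a vertex [x], the function [y |-> f (dist x y)] is an eigenvector of the
    adjacency matrix for [t]; normalized by [f 0 = 1], this is the cosine
    sequence of [t]. *)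
Definition distance_eigenfunction (R : rcfType) (T : finType) (e : rel T)
    (t : R) (f : nat -> R) : Prop :=
  forall x y : T,
    \sum_(z | e y z) f (dist e x z) = t * f (dist e x y).

Definition intersection_matrix (R : rcfType) (T : finType) (e : rel T) :
    'M[R]_((diameter e).+1) :=
  \matrix_(j, h) (intersection_number e h 1 j)%:R.

Section DistanceRegular.
Variables (R : rcfType) (T : finType) (e : rel T).
Hypothesis drg : distance_regular e.
Hypothesis Dgt0 : (0 < diameter e)%N.
Implicit Types x y z : T.

Let esym : symmetric e. Proof. by case: drg => -[]. Qed.
Let eirr : irreflexive e. Proof. by case: drg => -[]. Qed.
Let econ : connected_graph e. Proof. by case: drg. Qed.

Lemma vertex_exists : (0 < #|T|)%N.
Proof.
rewrite lt0n; apply: contraTneq Dgt0 => T0.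
have /= empty (x : T) : False by have := max_card (pred1 x); rewrite card1 T0.
by rewrite /diameter big1 // => x; case: (empty x).
Qed.

Lemma card_nbrs h j x y : dist e x y = h ->
  #|[set z | e y z & dist e x z == j]| = intersection_number e h 1 j.
Proof.
move=> dxy; have dyx : dist e y x = h by rewrite distC.
have -> : [set z | e y z & dist e x z == j] = sphere e 1 y :&: sphere e j x.
  by apply/setP => z; rewrite !inE dist_eq1 // distC.
have hD : (h <= diameter e)%N by rewrite -dxy dist_le_diameter.
case: (leqP j (diameter e)) => jD; first by case: drg => _ _ /(_ _ _ _ hD Dgt0 jD); apply.
have s0 u : sphere e j u = set0.
  apply/setP => v; rewrite !inE; apply/negP => /eqP dj.
  by have := dist_le_diameter e u v; rewrite dj leqNgt jD.
rewrite s0 setI0 cards0 /intersection_number; case: pickP => // u _.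
by rewrite s0 setI0 cards0.
Qed.

Lemma sum_nbrs_by_dist (f : nat -> R) x y :
  \sum_(z | e y z) f (dist e x z) =
    \sum_(j < (diameter e).+1) f j * (intersection_number e (dist e x y) 1 j)%:R.
Proof.
rewrite (partition_big (fun z => inord (dist e x z) : 'I_(diameter e).+1) xpredT) //=.
apply: eq_bigr => j _; rewrite -(card_nbrs j (erefl (dist e x y))).
rewrite -sum1_card natr_sum mulr_sumr.
have dj z : (inord (dist e x z) == j :> 'I_(diameter e).+1) = (dist e x z == j).
  by rewrite -val_eqE /= inordK // ltnS dist_le_diameter.
apply: eq_big => [z|z /andP[_]]; first by rewrite inE dj.
by rewrite dj => /eqP ->; rewrite mulr1.
Qed.

Lemma sum_nbrs (f : nat -> R) h x y : dist e x y = h ->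
  \sum_(z | e y z) f (dist e x z) =
    (drg_c e h)%:R * f h.-1 + (drg_a e h)%:R * f h + (drg_b e h)%:R * f h.+1.
Proof.
move=> dxy; rewrite /drg_c /drg_a /drg_b -!(card_nbrs _ dxy).
have cardE j : #|[set z | e y z & dist e x z == j]|%:R
    = \sum_(z | e y z) (dist e x z == j)%:R :> R.
  rewrite -sum1_card natr_sum (eq_bigl (fun z => e y z && (dist e x z == j))).
    by rewrite big_mkcondr; apply: eq_bigr => z _; case: eqP.
  by move=> z; rewrite inE.
rewrite !cardE !mulr_suml -!big_split /=; apply: eq_bigr => z eyz.
have [[-> gt]|dxz|->] := dist_step_cases esym econ x eyz; rewrite ?dxz dxy.
- move: gt; rewrite dxy eqxx => gt.
  have /negPf-> : h.-1 != h by lia.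
  have /negPf-> : h.-1 != h.+1 by lia.
  by rewrite mul1r !mul0r !addr0.
- case: h dxy => [|h] dxy.
    move/eqP: dxz; rewrite dxy dist_eq0 // => /eqP xz; subst z.
    by move/eqP: dxy; rewrite dist_eq0 // => /eqP xy; rewrite xy eirr in eyz.
  have /negPf-> : h.+1 != h by lia.
  have /negPf-> : h.+1 != h.+2 by lia.
  by rewrite eqxx mul1r !mul0r add0r addr0.
have /negPf-> : h.+1 != h.-1 by lia.
have /negPf-> : h.+1 != h by lia.
by rewrite eqxx mul1r !mul0r !add0r.
Qed.

Lemma drg_a0 : drg_a e 0 = 0%N.
Proof.
have /card_gt0P[x _] := vertex_exists.
rewrite /drg_a -(card_nbrs 0 (distxx e x)).
apply: eq_card0 => z; rewrite !inE dist_eq0 //.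
by apply: contraFF (eirr x) => /andP[exz /eqP xz]; rewrite {2}xz.
Qed.

Lemma drg_bD : drg_b e (diameter e) = 0%N.
Proof.
have [x [y dxy]] := exists_dist econ vertex_exists (leqnn (diameter e)).
rewrite /drg_b -(card_nbrs _ dxy); apply: eq_card0 => z; rewrite !inE.
apply/negP => /andP[_ /eqP dz].
by have := dist_le_diameter e x z; rewrite dz ltnn.
Qed.

Lemma drg_b_gt0 h : (h < diameter e)%N -> (0 < drg_b e h)%N.
Proof.
move=> hD; have [x [z dz]] := exists_dist econ vertex_exists hD.
have [y eyz dy] := dist_pred econ dz.
rewrite /drg_b -(card_nbrs _ dy) card_gt0; apply/set0Pn; exists z.
by rewrite !inE eyz dz /=.
Qed.

(** Moving [x] one step towards [y] lowers [dist x y] by one and keeps every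
    neighbour of [y] that was farther from [x] farther from the new vertex. *)
Lemma drg_b_decr h : (h < diameter e)%N -> (drg_b e h.+1 <= drg_b e h)%N.
Proof.
move=> hD; have [y [x dyx]] := exists_dist econ vertex_exists hD.
have [x' ex' dyx'] := dist_pred econ dyx.
rewrite distC // in dyx; rewrite distC // in dyx'.
rewrite /drg_b -(card_nbrs _ dyx) -(card_nbrs _ dyx').
apply/subset_leq_card/subsetP => z; rewrite !inE => /andP[eyz /eqP dz].
rewrite eyz /= eqn_leq -{1}dyx' dist_step //=.
have := dist_step econ z ex'.
by rewrite ![dist e z _]distC // dz.
Qed.

Lemma drg_abc h x y : dist e x y = h ->
  (drg_c e h + drg_a e h + drg_b e h = valency e)%N.
Proof.
move=> dxy; apply/eqP; rewrite -(eqr_nat R) !natrD.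
have := sum_nbrs (fun=> 1) dxy; have := sum_nbrs (fun=> 1) (distxx e y).
have -> : drg_c e 0 = drg_a e 0 by [].
by rewrite drg_a0 !mulr1 !add0r => -> <-.
Qed.

End DistanceRegular.

Section Eigenfunctions.
Variables (R : rcfType) (T : finType) (e : rel T).
Hypothesis drg : distance_regular e.
Hypothesis Dgt0 : (0 < diameter e)%N.
Implicit Types (x y z : T) (t : R) (f w : nat -> R).

Let esym : symmetric e. Proof. by case: drg => -[]. Qed.
Let econ : connected_graph e. Proof. by case: drg. Qed.

Local Notation D := (diameter e).

Lemma eigenvalue_adjacencyP t :
  eigenvalue (adjacency_matrix R e) t <->
  exists2 v : T -> R, forall y, \sum_(z | e y z) v z = t * v y
                    & exists y, v y != 0.
Proof.
have adjE (u : 'rV[R]_#|T|) j :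
    (u *m adjacency_matrix R e) 0 j
      = \sum_(z | e (enum_val j) z) u 0 (enum_rank z).
  rewrite mxE big_mkcond (reindex_onto (@enum_rank T) (@enum_val T predT)) /=; last first.
    by move=> i _; rewrite enum_valK.
  rewrite [RHS]big_mkcond; apply: eq_big => [z|z _]; first by rewrite enum_rankK eqxx.
  by rewrite mxE enum_rankK esym; case: ifP; rewrite ?mulr1 ?mulr0.
split=> [/eigenvalueP[u uA u0]|[v vA [y vy]]].
  exists (fun z => u 0 (enum_rank z)) => [y|].
    by have := adjE u (enum_rank y); rewrite uA mxE enum_rankK => ->.
  by have /rV0Pn[j uj] := u0; exists (enum_val j); rewrite enum_valK.
apply/eigenvalueP; exists (\row_j v (enum_val j)).
  apply/rowP => j; rewrite adjE !mxE -vA; apply: eq_bigr => z _.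
  by rewrite mxE enum_rankK.
by apply/eqP => /rowP/(_ (enum_rank y)); rewrite !mxE enum_rankK; apply/eqP.
Qed.

(** The recurrence computes [f h.+1] from the earlier values, as [b_h] is
    nonzero. *)
Lemma distance_eigenfunction_eq0 t f : distance_eigenfunction e t f ->
  f 0%N = 0 -> forall h, (h <= D)%N -> f h = 0.
Proof.
move=> ft f0; elim/ltn_ind => -[//|h] IH hD.
have [x [y dxy]] := exists_dist econ (vertex_exists Dgt0) (ltnW hD).
have := ft x y; rewrite (sum_nbrs drg Dgt0 f dxy) dxy.
rewrite (IH h) // 1?ltnW // (IH h.-1); [|lia|lia].
rewrite !mulr0 !add0r => /eqP; rewrite mulf_eq0 pnatr_eq0.
by have := drg_b_gt0 drg Dgt0 hD; rewrite lt0n => /negPf-> /= /eqP.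
Qed.

Lemma eigenvalue_intersectionP t :
  eigenvalue (intersection_matrix R e) t <->
  exists2 f, distance_eigenfunction e t f & f 0%N = 1.
Proof.
split=> [/eigenvalueP[u uL u0]|[f ft f0]].
  pose g n := u 0 (inord n).
  have gt : distance_eigenfunction e t g.
    move=> x y; rewrite (sum_nbrs_by_dist drg Dgt0).
    have := congr1 (fun m : 'rV[R]_(D.+1) => m 0 (inord (dist e x y))) uL.
    rewrite !mxE => <-; apply: eq_bigr => j _; rewrite mxE /g inord_val inordK //.
    by rewrite ltnS dist_le_diameter.
  have g0 : g 0%N != 0.
    apply: contraNneq u0 => g0; apply/eqP/rowP => j.
    have := distance_eigenfunction_eq0 gt g0 (ltn_ord j : (j <= D)%N).
    by rewrite /g inord_val mxE.
  exists (fun n => g n / g 0%N); last by rewrite divff.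
  by move=> x y; rewrite -mulr_suml gt mulrA.
apply/eigenvalueP; exists (\row_j f j).
  apply/rowP => h; rewrite !mxE.
  have [x [y dxy]] := exists_dist econ (vertex_exists Dgt0) (ltn_ord h : (h <= D)%N).
  have := ft x y; rewrite (sum_nbrs_by_dist drg Dgt0) dxy => <-.
  by apply: eq_bigr => j _; rewrite !mxE.
by apply/eqP => /rowP/(_ ord0); rewrite !mxE /= f0; apply/eqP/oner_neq0.
Qed.

(** From a distance eigenfunction one gets an eigenvector by fixing a base
    vertex; conversely, summing an eigenvector over the spheres around a vertex
    of its support gives an eigenvector of the transposed matrix. *)
Lemma eigenvalue_intersection_matrix t :
  eigenvalue (adjacency_matrix R e) t = eigenvalue (intersection_matrix R e) t.
Proof.
apply/idP/idP => [/eigenvalue_adjacencyP[v vt [x vx]]|]; last first.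
  case/eigenvalue_intersectionP => f ft f0; apply/eigenvalue_adjacencyP.
  have /card_gt0P[x _] := vertex_exists Dgt0.
  exists (fun z => f (dist e x z)) => [y|]; first exact: ft.
  by exists x; rewrite distxx f0 oner_neq0.
pose s : 'rV[R]_(D.+1) := \row_i \sum_(y | dist e x y == i) v y.
have s0 : s != 0.
  apply/eqP => /rowP/(_ ord0); rewrite !mxE (big_pred1 x).
    exact/eqP.
  by move=> y; rewrite /= (dist_eq0 econ) eq_sym.
have sL : s *m (intersection_matrix R e)^T = t *: s.
  apply/rowP => j; rewrite !mxE mulr_sumr.
  under [RHS]eq_bigr do rewrite -vt.
  rewrite (exchange_big_dep xpredT) //=.
  rewrite [RHS](partition_big (fun z => inord (dist e x z) : 'I_(D.+1)) xpredT) //=.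
  apply: eq_bigr => h _; rewrite !mxE mulr_suml.
  have dh z : (inord (dist e x z) == h :> 'I_(D.+1)) = (dist e x z == h).
    by rewrite -val_eqE /= inordK // ltnS dist_le_diameter.
  rewrite [RHS](eq_bigl _ _ dh); apply: eq_bigr => z /eqP dz.
  rewrite -(card_nbrs drg Dgt0 j dz) -sum1_card natr_sum mulr_sumr.
  apply: eq_big => [y|y _]; last by rewrite mulr1.
  by rewrite inE andbC esym.
have d0 : \det (intersection_matrix R e - t%:M) = 0.
  rewrite -det_tr; apply/eqP/det0P; exists s => //.
  by rewrite linearB /= tr_scalar_mx mulmxBr sL mul_mx_scalar subrr.
move/eqP/det0P: d0 => [u u0 uL]; apply/eigenvalueP; exists u => //.
by move/eqP: uL; rewrite mulmxBr mul_mx_scalar subr_eq0 => /eqP.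
Qed.

Lemma eigenvalue_cosines t : eigenvalue (adjacency_matrix R e) t ->
  exists2 f, distance_eigenfunction e t f & f 0%N = 1.
Proof. by rewrite eigenvalue_intersection_matrix => /eigenvalue_intersectionP. Qed.

(** With [E x y = f (dist x y)], the matrix [E * E] again has entries that
    depend on the distance only, and rows that are eigenvectors for [t]; the
    recurrence then makes it a multiple of [E]. *)
Lemma distance_eigenfunction_sqr t f : distance_eigenfunction e t f -> f 0%N = 1 ->
  exists2 c : R, 0 < c & forall x y,
    \sum_z f (dist e x z) * f (dist e z y) = c * f (dist e x y).
Proof.
move=> ft f0.
pose G h := \sum_(i < D.+1) \sum_(j < D.+1)
  f i * f j * (intersection_number e h i j)%:R.
have GE x y : \sum_z f (dist e x z) * f (dist e z y) = G (dist e x y).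
  rewrite (partition_big (fun z => inord (dist e x z) : 'I_(D.+1)) xpredT) //=.
  apply: eq_bigr => i _.
  rewrite (partition_big (fun z => inord (dist e z y) : 'I_(D.+1)) xpredT) //=.
  apply: eq_bigr => j _.
  have dh u z (h : 'I_(D.+1)) :
      (inord (dist e u z) == h :> 'I_(D.+1)) = (dist e u z == h).
    by rewrite -val_eqE /= inordK // ltnS dist_le_diameter.
  have <- : #|sphere e i x :&: sphere e j y| = intersection_number e (dist e x y) i j.
    by case: drg => _ _; apply; rewrite ?dist_le_diameter // -ltnS.
  rewrite -sum1_card natr_sum mulr_sumr; apply: eq_big => [z|z].
    by rewrite !inE !dh (distC esym econ y).
  by rewrite !dh mulr1 => /andP[/eqP -> /eqP ->].
have Gt : distance_eigenfunction e t G.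
  move=> x y; under eq_bigr do rewrite -GE.
  rewrite exchange_big -GE mulr_sumr /=; apply: eq_bigr => z _.
  by rewrite -mulr_sumr ft mulrCA.
exists (G 0%N) => [|x y].
  have /card_gt0P[x _] := vertex_exists Dgt0.
  rewrite -(distxx e x) -GE (bigD1 x) //= distxx f0 mulr1 ltr_pwDl //.
  by apply: sumr_ge0 => z _; rewrite (distC esym econ z) -expr2 sqr_ge0.
rewrite GE; apply/eqP; rewrite -subr_eq0; apply/eqP.
apply: (@distance_eigenfunction_eq0 t (fun h => G h - G 0%N * f h)).
- move=> u v; rewrite sumrB -mulr_sumr Gt ft; ring.
- by rewrite f0 mulr1 subrr.
exact: dist_le_diameter.
Qed.

Lemma distance_eigenfunction_form t f : distance_eigenfunction e t f -> f 0%N = 1 ->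
  exists2 c : R, 0 < c & forall v : T -> R,
    c * \sum_x \sum_y v x * v y * f (dist e x y)
      = \sum_z (\sum_x v x * f (dist e x z)) ^+ 2.
Proof.
move=> ft f0; have [c c0 fE] := distance_eigenfunction_sqr ft f0.
exists c => // v.
have sqE z : (\sum_x v x * f (dist e x z)) ^+ 2
    = \sum_x \sum_y v x * v y * (f (dist e x z) * f (dist e z y)).
  rewrite expr2 mulr_suml; apply: eq_bigr => x _.
  rewrite mulr_sumr; apply: eq_bigr => y _.
  by rewrite (distC esym econ z); ring.
under [RHS]eq_bigr do rewrite sqE.
rewrite [RHS]exchange_big mulr_sumr; apply: eq_bigr => x _.
rewrite [RHS]exchange_big mulr_sumr; apply: eq_bigr => y _.
by rewrite -mulr_sumr fE; ring.
Qed.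

Lemma distance_eigenfunction_ge0 t f (v : T -> R) :
  distance_eigenfunction e t f -> f 0%N = 1 ->
  0 <= \sum_x \sum_y v x * v y * f (dist e x y).
Proof.
move=> ft f0; have [c c0 fE] := distance_eigenfunction_form ft f0.
rewrite -(pmulr_rge0 _ c0) fE; apply: sumr_ge0 => z _; exact: sqr_ge0.
Qed.

Lemma distance_eigenfunction_kernel t f (v : T -> R) :
  distance_eigenfunction e t f -> f 0%N = 1 ->
  \sum_x \sum_y v x * v y * f (dist e x y) = 0 ->
  forall z, \sum_x v x * f (dist e x z) = 0.
Proof.
move=> ft f0; have [c c0 fE] := distance_eigenfunction_form ft f0.
move=> Q0 z; have /eqP := fE v; rewrite Q0 mulr0 eq_sym psumr_eq0.
  by move=> /allP/(_ z); rewrite mem_index_enum sqrf_eq0 => /(_ isT)/eqP.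
by move=> u _; exact: sqr_ge0.
Qed.

End Eigenfunctions.

(** * The spectrum of a graph with classical parameters *)

(** This is [b_m / b ^ m - [m]], with the division carried out. *)
Definition classical_eigenvalue (R : rcfType) (D : nat) (b : int)
    (alpha beta : R) (m : nat) : R :=
  qnum R b (D - m) * (beta - alpha * qnum R b m) - qnum R b m.

Section ClassicalParameters.
Variables (R : rcfType) (T : finType) (e : rel T).
Variables (D : nat) (b : int) (alpha beta : R).
Hypothesis b_ge2 : (2 : int) <= b.
Hypothesis cl : classical_parameters e D b alpha beta.

Local Notation B := (b%:~R : R).
Local Notation qn := (qnum R b).
Local Notation theta := (classical_eigenvalue D b alpha beta).

Let drg : distance_regular e. Proof. by case: cl. Qed.
Let econ : connected_graph e. Proof. by case: drg. Qed.
Let diamD : diameter e = D. Proof. by case: cl => _ []. Qed.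
Let D_ge3 : (3 <= D)%N. Proof. by case: cl => _ []. Qed.
Let Dgt0 : (0 < diameter e)%N. Proof. by rewrite diamD; lia. Qed.

Lemma base_ge2 : 2 <= B.
Proof. by rewrite (_ : 2 = (2 : int)%:~R) // ler_int. Qed.

Let B_neq0 : B != 0. Proof. by apply: lt0r_neq0; have := base_ge2; lra. Qed.
Let B1_neq0 : B - 1 != 0. Proof. by apply: lt0r_neq0; have := base_ge2; lra. Qed.

Lemma qnumE i : qn i = (B ^+ i - 1) / (B - 1).
Proof. by rewrite subrX1 mulrC mulKf. Qed.

Lemma qnum0 : qn 0 = 0.
Proof. by rewrite /qnum big_ord0. Qed.

Lemma qnumS i : qn i.+1 = 1 + B * qn i.
Proof. by rewrite !qnumE exprS; field. Qed.

Lemma qnum_ge i : i%:R <= qn i.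
Proof.
elim: i => [|i IH]; first by rewrite qnum0.
rewrite qnumS -natr1; have := base_ge2; have : (0 : R) <= i%:R by [].
by nra.
Qed.

Lemma classical_b i : (i <= D)%N ->
  (drg_b e i)%:R = (qn D - qn i) * (beta - alpha * qn i).
Proof.
rewrite leq_eqVlt => /orP[/eqP->|iD]; last by case: cl => _ _ _ -> //; lia.
by rewrite subrr mul0r -diamD (drg_bD drg).
Qed.

Lemma classical_c i : (i <= D)%N ->
  (drg_c e i)%:R = qn i * (1 + alpha * qn i.-1).
Proof.
case: i => [|i] iD; last by case: cl => _ _ _ _ -> //.
by rewrite (_ : drg_c e 0 = drg_a e 0) // (drg_a0 drg) // qnum0 mul0r.
Qed.

Lemma classical_a i : (i <= D)%N ->
  (drg_a e i)%:R = qn D * beta - (drg_b e i)%:R - (drg_c e i)%:R.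
Proof.
move=> iD; have iD' : (i <= diameter e)%N by rewrite diamD.
have [x [y dxy]] := exists_dist econ (vertex_exists Dgt0) iD'.
have := congr1 (fun n => n%:R : R) (drg_abc R drg Dgt0 dxy).
rewrite !natrD [X in _ = X]classical_b // qnum0 mulr0 !subr0 => <-.
by ring.
Qed.

Lemma classical_eigenvalueE m : (m <= D)%N ->
  theta m = (drg_b e m)%:R / B ^+ m - qn m.
Proof.
move=> mD; rewrite classical_b // /classical_eigenvalue !qnumE.
rewrite -[in B ^+ D](subnK mD) exprD.
by field; rewrite B1_neq0 expf_neq0.
Qed.

Lemma classical_eigenvalue_decr m : (m < D)%N -> theta m.+1 < theta m.
Proof.
move=> mD; rewrite !classical_eigenvalueE //; last exact: ltnW.
have B0 : 0 < B by have := base_ge2; lra.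
have := drg_b_decr drg Dgt0 (h := m); rewrite diamD => /(_ mD).
rewrite -(ler_nat R) => bb.
have : (drg_b e m.+1)%:R / B ^+ m.+1 <= (drg_b e m)%:R / B ^+ m.
  apply: le_trans (_ : (drg_b e m)%:R / B ^+ m.+1 <= _).
    by rewrite ler_pM2r // invr_gt0 exprn_gt0.
  rewrite ler_wpM2l // lef_pV2 ?posrE ?exprn_gt0 // ler_eXn2l //.
    by have := base_ge2; lra.
have : qn m < qn m.+1.
  rewrite qnumS; have := qnum_ge m; have := base_ge2.
  have : (0 : R) <= m%:R by []. by nra.
by lra.
Qed.

(** In the variable [x = b ^ - i], the operator
    [f |-> c_i f (i - 1) + a_i f i + b_i f (i + 1)] maps [x ^ m] to a
    combination of [x ^ m], [x ^ (m - 1)] and [x ^ (m - 2)], because [b_i] and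
    [c_i] are quadratic in [b ^ i]; the negative powers that could arise for
    [m <= 1] cancel.  The coefficient of [x ^ m] is the [m]-th classical
    eigenvalue.  So the Vandermonde matrix conjugates the intersection matrix
    to a triangular one. *)
Lemma intersection_matrix_conj_trig :
  exists V U : 'M[R]_((diameter e).+1),
    [/\ V \in unitmx, is_trig_mx U, forall m, U m m = theta m
      & V *m intersection_matrix R e = U *m V].
Proof.
(* [g1 m] and [g2 m] are the coefficients of [x ^ (m - 1)] and [x ^ (m - 2)],
   read off from [b_i] and [c_i] as polynomials in [b ^ i]. *)
pose h := (B - 1)^-1; pose P := qn D + h.
pose g1 m := - (P * alpha * h + h * (beta + alpha * h)) * ((B ^+ m)^-1 - 1)
  + (h * (1 - alpha * h) - alpha * h ^+ 2 / B) * (B ^+ m - 1).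
pose g2 m := alpha * h ^+ 2 * ((B ^+ m)^-1 - 1)
  + alpha * h ^+ 2 / B * (B ^+ m - 1).
have g1_eq0 n : (n < 1)%N -> g1 n = 0.
  by case: n => // _; rewrite /g1 expr0; field.
have g2_eq0 n : (n < 2)%N -> g2 n = 0.
  by case: n => [|[|//]] _; rewrite /g2 ?expr0 ?expr1; field.
pose V := Vandermonde (diameter e).+1 (\row_(j < (diameter e).+1) (B ^+ j)^-1).
pose U : 'M[R]_((diameter e).+1) := \matrix_(m, j)
  ((j + 0 == m)%N%:R * theta m + (j + 1 == m)%N%:R * g1 m
    + (j + 2 == m)%N%:R * g2 m).
exists V, U; split.
- rewrite unitmxE unitfE det_Vandermonde; apply/prodf_neq0 => i _.
  apply/prodf_neq0 => j ij; rewrite !mxE subr_eq0 (inj_eq invr_inj).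
  by rewrite gt_eqF // ltr_eXn2l //; have := base_ge2; lra.
- apply/is_trig_mxP => m j mj; rewrite mxE.
  have /negPf-> : (j + 0)%N != m by lia.
  have /negPf-> : (j + 1)%N != m by lia.
  have /negPf-> : (j + 2)%N != m by lia.
  by rewrite !mul0r !addr0.
- move=> m; rewrite mxE addn0 eqxx mul1r.
  have /negPf-> : (m + 1)%N != m by lia.
  have /negPf-> : (m + 2)%N != m by lia.
  by rewrite !mul0r !addr0.
apply/matrixP => m i; rewrite !mxE.
have iD : (i <= D)%N by rewrite -diamD -ltnS.
have mD : (m <= D)%N by rewrite -diamD -ltnS.
have [x [y dxy]] := exists_dist econ (vertex_exists Dgt0) (ltn_ord i : (i <= _)%N).
pose f (m j : nat) : R := (B ^+ j)^-1 ^+ m.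
have -> : \sum_j V m j * intersection_matrix R e j i
    = \sum_(z | e y z) f m (dist e x z).
  rewrite (sum_nbrs_by_dist drg Dgt0) dxy.
  by apply: eq_bigr => j _; rewrite !mxE.
rewrite (sum_nbrs drg Dgt0 _ dxy).
have Bi_neq0 : B ^+ i != 0 by rewrite expf_neq0.
have Bm_neq0 : B ^+ m != 0 by rewrite expf_neq0.
have shift k (g : R) : ((m < k)%N -> g = 0) ->
    \sum_(j < (diameter e).+1) (j + k == m)%N%:R * g * f j i
      = g * (B ^+ i) ^+ k * f m i.
  move=> g0; case: (ltnP m k) => mk.
    by rewrite g0 // !mul0r big1 // => j _; rewrite mulr0 mul0r.
  have jm : (m - k < (diameter e).+1)%N by have := ltn_ord m; lia.
  rewrite (bigD1 (Ordinal jm)) //= subnK // eqxx mul1r big1 ?addr0 => [|j].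
    rewrite /f -mulrA; congr (_ * _).
    by rewrite -[in RHS](subnK mk) exprD mulrCA -exprMn divff // expr1n mulr1.
  rewrite -val_eqE /= => jmk; have /negPf-> : (j + k)%N != m by lia.
  by rewrite !mul0r.
have -> : \sum_j U m j * V j i
    = theta m * f m i + g1 m * B ^+ i * f m i + g2 m * (B ^+ i) ^+ 2 * f m i.
  transitivity (\sum_(j < (diameter e).+1) ((j + 0 == m)%N%:R * theta m * f j i
      + (j + 1 == m)%N%:R * g1 m * f j i + (j + 2 == m)%N%:R * g2 m * f j i)).
    by apply: eq_bigr => j _; rewrite !mxE !mulrDl.
  rewrite !big_split /= !shift ?expr0 ?expr1 ?mulr1 //.
    exact: g2_eq0.
  exact: g1_eq0.
have -> : f m i.+1 = f m i / B ^+ m.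
  by rewrite /f exprSr invfM exprMn -(exprVn B m).
have -> : (drg_c e i)%:R * f m i.-1 = (drg_c e i)%:R * f m i * B ^+ m.
  case: {dxy iD Bi_neq0 shift} (nat_of_ord i) => [|j].
    by rewrite (_ : drg_c e 0 = drg_a e 0) // (drg_a0 drg) // !mul0r.
  by rewrite /f /= exprSr invfM exprMn -!mulrA (exprVn B m) mulVf // mulr1.
rewrite classical_a // classical_b // classical_c //.
have -> : qn i * (1 + alpha * qn i.-1)
    = qn i * (1 + alpha * ((B ^+ i / B - 1) / (B - 1))).
  case: {dxy iD Bi_neq0 shift} (nat_of_ord i) => [|j]; first by rewrite qnum0 !mul0r.
  by rewrite /= (qnumE j) exprSr mulfK.
rewrite /classical_eigenvalue /g1 /g2 /P /h !qnumE.
have -> : B ^+ (D - m) = B ^+ D / B ^+ m.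
  by rewrite -[in B ^+ D](subnK mD) exprD mulfK.
move: (B ^+ D) (B ^+ m) (B ^+ i) Bm_neq0 Bi_neq0 => Z Y X Y0 X0.
by field; rewrite B1_neq0 B_neq0 Y0.
Qed.

Lemma eigenvalue_classical t :
  eigenvalue (adjacency_matrix R e) t = (t \in mkseq theta D.+1).
Proof.
rewrite (eigenvalue_intersection_matrix drg Dgt0).
have [V [U [Vunit Utrig Udiag VL]]] := intersection_matrix_conj_trig.
transitivity (eigenvalue U t).
  apply/eigenvalueP/eigenvalueP => -[u uE u0].
    exists (u *m invmx V).
      apply: (can_inj (mulmxK Vunit)).
      by rewrite -!mulmxA -VL mulKmx // uE -scalemxAl mulmxKV.
    by apply: contraNneq u0 => u0; rewrite -(mulmxKV Vunit u) u0 mul0mx.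
  exists (u *m V); first by rewrite -mulmxA VL mulmxA uE scalemxAl.
  by apply: contraNneq u0 => u0; rewrite -(mulmxK Vunit u) u0 mul0mx.
have DS : D.+1 = (diameter e).+1 by rewrite diamD.
rewrite eigenvalue_root_char char_poly_trig // DS.
rewrite -(big_map (fun i => U i i) xpredT (fun c => 'X - c%:P)) root_prod_XsubC.
apply/mapP/mapP => -[i iD ->].
  by exists (i : nat); rewrite ?Udiag // mem_iota; case: (i) => j /=; rewrite add0n.
rewrite mem_iota add0n in iD.
by exists (Ordinal iD); rewrite ?mem_index_enum ?Udiag.
Qed.

Lemma spectrum_classical (s : seq R) : spectrum e s -> s = mkseq theta D.+1.
Proof.
case=> s_sorted sE; apply: (irr_sorted_eq (leT := fun t u : R => u < t)) => //.
- by move=> t u v ut tv; apply: lt_trans tv ut.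
- apply: (path_sorted (x := theta 0 + 1)).
  apply/(pathP 0) => i; rewrite size_mkseq => iD.
  rewrite nth_mkseq //; case: i iD => [|i] iD /=; first by rewrite ltrDl.
  by rewrite nth_mkseq ?(ltnW iD) // classical_eigenvalue_decr.
by move=> t; rewrite sE eigenvalue_classical.
Qed.

(** ** Consequences of tightness *)

Hypothesis tig : tight R e.

Local Notation n := (qn D.-1).

Let qD : qn D = 1 + B * n.
Proof. by rewrite -qnumS prednK //; lia. Qed.

Let q1 : qn 1 = 1.
Proof. by rewrite qnumS qnum0 mulr0 addr0. Qed.

Lemma qnum_pred_ge2 : 2 <= n.
Proof. by apply: le_trans (qnum_ge _); rewrite ler_nat; lia. Qed.

Let b1E : (drg_b e 1)%:R = B * n * (beta - alpha).
Proof. by rewrite classical_b ?q1 ?qD; [ring|lia]. Qed.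

Let c1E : (drg_c e 1)%:R = 1 :> R.
Proof. by rewrite classical_c ?q1 ?qnum0; [ring|lia]. Qed.

Lemma classical_valency : (valency e)%:R = qn D * beta.
Proof. by rewrite classical_b // qnum0; ring. Qed.

Lemma alpha_lt_beta : alpha < beta.
Proof.
have : (0 : R) < (drg_b e 1)%:R by rewrite ltr0n drg_b_gt0 // diamD; lia.
have Bn : 0 < B * n by have := base_ge2; have := qnum_pred_ge2; nra.
by rewrite b1E (pmulr_rgt0 _ Bn) subr_gt0.
Qed.

(** With the values of the two eigenvalues, the tightness equation factors as
    [[D] b n (beta - alpha) (a_1 + 1) (beta - 1 - alpha n) = 0], where
    [n = [D - 1]]. *)
Lemma tight_beta : beta = 1 + alpha * n.
Proof.
case: tig => _ _ _ [s [/spectrum_classical-> ]].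
cbv zeta; rewrite diamD.
have D1 : (1 < D.+1)%N by lia.
rewrite (nth_mkseq 0 _ D1) (nth_mkseq 0 _ (ltnSn D)).
rewrite {1 2}/classical_eigenvalue subnn subn1 qnum0 q1 mul0r sub0r mulr1.
have a1E := @classical_a 1 (ltnW (ltnW D_ge3)).
have := ler0n R (drg_a e 1); move: a1E.
rewrite classical_valency b1E c1E qD.
set a := (drg_a e 1)%:R; move=> a1E a1_ge0.
have a1_neq0 : a + 1 != 0 by apply: lt0r_neq0; lra.
pose K := (1 + B * n) * beta => tE.
have {}tE : ((n * (beta - alpha) - 1) * (a + 1) + K) * (- (1 + B * n) * (a + 1) + K)
    = - (K * a * (B * n * (beta - alpha))).
  apply: (mulIf (x := (a + 1) ^- 2)); first by rewrite invr_eq0 expf_neq0.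
  rewrite [RHS]mulNr /K -tE; field.
  exact: a1_neq0.
have {tE} : (1 + B * n) * B * n * (beta - alpha) * (a + 1)
    * (beta - (1 + alpha * n)) = 0.
  move/eqP: tE; rewrite -addr_eq0 /K a1E => /eqP <-; ring.
have := base_ge2; have := qnum_pred_ge2; have := alpha_lt_beta => ab n2 B2 /eqP.
rewrite !mulf_eq0 (negPf B_neq0) (negPf a1_neq0) subr_eq0 (gt_eqF ab).
have /negPf-> : n != 0 by apply: lt0r_neq0; lra.
have /negPf-> : 1 + B * n != 0 by apply: lt0r_neq0; nra.
by rewrite /= subr_eq0 => /eqP.
Qed.

Lemma tight_a1 : (drg_a e 1)%:R = alpha * n * (1 + B).
Proof.
rewrite classical_a; last by lia.
by rewrite b1E c1E qD tight_beta; ring.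
Qed.

(** If [alpha] vanished, then so would every [a_i], and the parity of the
    distance to a vertex would be a proper 2-colouring. *)
Lemma tight_alpha_gt0 : 0 < alpha.
Proof.
have := base_ge2; have := qnum_pred_ge2; have := ler0n R (drg_a e 1).
rewrite tight_a1 => a0 n2 B2.
have nB : 0 < n * (1 + B) by nra.
have alpha_ge0 : 0 <= alpha by rewrite -(pmulr_lge0 _ nB) mulrA.
rewrite lt_def alpha_ge0 andbT; apply/eqP => alpha0.
have aE i : (i <= D)%N -> drg_a e i = 0%N.
  move=> iD; apply/eqP; rewrite -(eqr_nat R) classical_a //.
  by rewrite classical_b // classical_c // tight_beta alpha0; apply/eqP; ring.
case: tig => _ _ nb _; apply: nb.
have /card_gt0P[x _] := vertex_exists Dgt0.
exists (fun y => odd (dist e x y)) => y z eyz.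
have esym : symmetric e by case: drg => -[].
have [[-> gt0]|dxz|->] := dist_step_cases esym econ x eyz.
- by case: (dist e x y) gt0 => //= d _; case: odd.
- have : dist e x y = dist e x y by [].
  move/(card_nbrs drg Dgt0 (dist e x y)); rewrite -/(drg_a e _) aE; last first.
    by rewrite -diamD dist_le_diameter.
  by move/eqP; rewrite cards_eq0 => /eqP/setP/(_ z); rewrite !inE eyz dxz eqxx.
by rewrite /=; case: odd.
Qed.

End ClassicalParameters.

(** * Clique and local inequalities from the extreme eigenvalues *)

Section TightGraph.
Variables (R : rcfType) (T : finType) (e : rel T).
Variables (D : nat) (b : int) (alpha beta : R).
Hypothesis b_ge2 : (2 : int) <= b.
Hypothesis cl : classical_parameters e D b alpha beta.
Hypothesis tig : tight R e.
Implicit Types (x y z : T) (t : R) (f : nat -> R).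

Local Notation B := (b%:~R : R).
Local Notation qn := (qnum R b).
Local Notation theta := (classical_eigenvalue D b alpha beta).
Local Notation n := (qn D.-1).

Let drg : distance_regular e. Proof. by case: cl. Qed.
Let esym : symmetric e. Proof. by case: drg => -[]. Qed.
Let eirr : irreflexive e. Proof. by case: drg => -[]. Qed.
Let econ : connected_graph e. Proof. by case: drg. Qed.
Let diamD : diameter e = D. Proof. by case: cl => _ []. Qed.
Let D_ge3 : (3 <= D)%N. Proof. by case: cl => _ []. Qed.
Let Dgt0 : (0 < diameter e)%N. Proof. by rewrite diamD; lia. Qed.

Let B_ge2 : 2 <= B. Proof. exact: base_ge2. Qed.
Let n_ge2 : 2 <= n. Proof. exact: (qnum_pred_ge2 b_ge2 cl). Qed.
Let alpha_gt0 : 0 < alpha. Proof. exact: (tight_alpha_gt0 b_ge2 cl tig). Qed.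
Let betaE : beta = 1 + alpha * n. Proof. exact: (tight_beta b_ge2 cl tig). Qed.

Lemma qnum_diameter : qn D = 1 + B * n.
Proof. by rewrite -qnumS // prednK //; lia. Qed.

Lemma beta_gt0 : 0 < beta.
Proof. by rewrite betaE addr_gt0 // mulr_gt0 //; have := n_ge2; lra. Qed.

Let Bn_gt0 : 0 < B * n.
Proof. by rewrite mulr_gt0 //; have := B_ge2; have := n_ge2; lra. Qed.

Let qD_gt0 : 0 < 1 + B * n.
Proof. by rewrite addr_gt0 // Bn_gt0. Qed.

Lemma tight_valency : (valency e)%:R = (1 + B * n) * beta.
Proof. by rewrite (classical_valency b_ge2 cl) qnum_diameter. Qed.

Lemma tight_b1 : (drg_b e 1)%:R = B * n * (beta - alpha).
Proof.
rewrite (classical_b b_ge2 cl); last by lia.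
by rewrite qnum_diameter qnumS // qnum0; ring.
Qed.

Lemma tight_c2 : (drg_c e 2)%:R = (1 + B) * (1 + alpha).
Proof.
rewrite (classical_c b_ge2 cl); last by lia.
by rewrite !qnumS // qnum0; ring.
Qed.

Lemma cosine_values t f : distance_eigenfunction e t f -> f 0%N = 1 ->
  (valency e)%:R * f 1%N = t /\
  1 + (drg_a e 1)%:R * f 1%N + (drg_b e 1)%:R * f 2%N = t * f 1%N.
Proof.
move=> ft f0; split.
  have [x [y dxy]] := exists_dist econ (vertex_exists Dgt0) (leq0n _).
  have := ft x y; rewrite (sum_nbrs drg Dgt0 f dxy) dxy f0 [RHS]mulr1.
  by rewrite (_ : drg_c e 0 = drg_a e 0) // (drg_a0 drg) // !mul0r !add0r => ->.
have [x [y dxy]] := exists_dist econ (vertex_exists Dgt0) Dgt0.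
have := ft x y; rewrite (sum_nbrs drg Dgt0 f dxy) dxy f0 mulr1 => <-.
rewrite (classical_c b_ge2 cl); last by lia.
by rewrite qnumS // qnum0; ring.
Qed.

Lemma exists_cosines m : (m <= D)%N ->
  exists2 f, distance_eigenfunction e (theta m) f & f 0%N = 1.
Proof.
move=> mD; apply: (eigenvalue_cosines drg Dgt0).
rewrite (eigenvalue_classical b_ge2 cl); apply/mapP; exists m => //.
by rewrite mem_iota.
Qed.

Lemma least_eigenvalue_cosines :
  exists t, exists f, [/\ distance_eigenfunction e t f, f 0%N = 1, f 1%N = - beta^-1
    & f 2%N = (1 + alpha) / (beta * (beta - alpha))].
Proof.
have [f ft f0] := exists_cosines (leqnn D); exists (theta D), f.
have [] := cosine_values ft f0.
rewrite tight_valency tight_b1 (tight_a1 b_ge2 cl tig).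
rewrite {1 2}/classical_eigenvalue subnn qnum0 mul0r sub0r qnum_diameter.
have Bn : 1 + B * n != 0 by rewrite lt0r_neq0 ?qD_gt0.
have Bn' : B * n != 0 by rewrite lt0r_neq0 ?Bn_gt0.
have b0 : beta != 0 by apply: lt0r_neq0; exact: beta_gt0.
have ba : beta - alpha != 0.
  by apply: lt0r_neq0; rewrite subr_gt0 (alpha_lt_beta b_ge2 cl).
move=> f1E f2E.
have f1 : f 1%N = - beta^-1.
  apply: (mulfI (mulf_neq0 Bn b0)); rewrite f1E; field; exact: b0.
split=> //; apply: (mulfI (mulf_neq0 Bn' ba)).
rewrite f1 in f2E; apply: (addrI (1 + alpha * n * (1 + B) * - beta^-1)).
rewrite f2E; move: b0 ba; rewrite betaE => b0 ba; field.
by rewrite b0 ba.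
Qed.

Section Cliques.
Variable K : {set T}.
Hypothesis cliqueK : {in K &, forall y z, y != z -> e y z}.

Let clique_form f : f 0%N = 1 ->
  \sum_y \sum_z (y \in K)%:R * (z \in K)%:R * f (dist e y z)
    = #|K|%:R * (1 + (#|K|%:R - 1) * f 1%N).
Proof.
move=> f0; rewrite mulr_natl -sumr_const [RHS]big_mkcond.
apply: eq_bigr => y _; case: ifP => yK; last first.
  by rewrite big1 // => z _; rewrite !mul0r.
transitivity (\sum_(z in K) ((y == z)%:R * (1 - f 1%N) + f 1%N)).
  rewrite [RHS]big_mkcond; apply: eq_bigr => z _; rewrite !mul1r.
  case: ifP => zK; last by rewrite mul0r.
  rewrite mul1r; case: eqVneq => [<-|yz].
    by rewrite distxx f0 mul1r subrK.
  have /eqP -> : dist e y z == 1%N by rewrite dist_eq1 // cliqueK.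
  by rewrite mul0r add0r.
rewrite big_split /= sumr_const -mulr_suml (bigD1 y) //= eqxx big1 ?addr0.
  by rewrite mul1r -[f 1%N *+ _]mulr_natl; ring.
by move=> z /andP[_ /negPf]; rewrite eq_sym => ->.
Qed.

(** The Delsarte bound: the form of the least eigenvalue is nonnegative at the
    characteristic vector of [K]. *)
Lemma clique_card_le : #|K|%:R <= 1 + beta.
Proof.
have [t [f [ft f0 f1 _]]] := least_eigenvalue_cosines.
have := distance_eigenfunction_ge0 drg Dgt0 (fun y => (y \in K)%:R) ft f0.
rewrite clique_form // f1.
have := beta_gt0; case: (posnP #|K|) => [->|K0] b0; first by lra.
rewrite pmulr_rge0 ?ltr0n // mulrN subr_ge0 ler_pdivrMr // mul1r.
by lra.
Qed.

(** The characteristic vector of a clique of the maximal size lies in the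
    kernel of the form of the least eigenvalue.  At a vertex [z] whose distances
    to the clique are all 1 or 2, the kernel relation is a linear equation for
    the number of neighbours of [z] in the clique. *)
Lemma maximal_clique_nbrs z : #|K|%:R = 1 + beta -> z \notin K ->
  (exists2 y, y \in K & e z y) -> #|[set y in K | e z y]|%:R = 1 + alpha :> R.
Proof.
move=> Kmax zK [y0 y0K ey0].
have [t [f [ft f0 f1 f2]]] := least_eigenvalue_cosines.
have b0 := beta_gt0.
have bn : beta != 0 by exact: lt0r_neq0.
have ba : beta - alpha != 0.
  by apply: lt0r_neq0; rewrite subr_gt0 (alpha_lt_beta b_ge2 cl).
have ker : \sum_y (y \in K)%:R * f (dist e y z) = 0.
  apply: (distance_eigenfunction_kernel drg Dgt0 ft f0).
  by rewrite clique_form // f1 Kmax; field.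
have dK y : y \in K -> f (dist e y z) = f 2%N + (e z y)%:R * (f 1%N - f 2%N).
  move=> yK; have dzy0 : dist e z y0 = 1%N by apply/eqP; rewrite dist_eq1.
  have le2 : (dist e y z <= 2)%N.
    rewrite distC //; have [->|yy0] := eqVneq y y0; first by rewrite dzy0.
    by rewrite -dzy0 dist_step // cliqueK // eq_sym.
  have : dist e y z != 0%N by rewrite dist_eq0 //; apply: contraNneq zK => <-.
  rewrite esym -(dist_eq1 eirr econ).
  case: (dist e y z) le2 => [|[|[|//]]] //= _ _.
    by rewrite mul1r addrC subrK.
  by rewrite mul0r addr0.
have : #|[set y in K | e z y]|%:R * (f 1%N - f 2%N) + #|K|%:R * f 2%N = 0.
  transitivity (\sum_(y in K) (f 2%N + (e z y)%:R * (f 1%N - f 2%N))).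
    rewrite big_split /= sumr_const -mulr_suml -natr_sum -[f 2%N *+ _]mulr_natl addrC.
    congr (_%:R * _ + _); rewrite -sum1dep_card big_mkcondr.
    by apply: eq_bigr => y _; case: (e z y).
  rewrite -[RHS]ker [LHS]big_mkcond; apply: eq_bigr => y _.
  by case: ifP => yK; rewrite ?mul0r // mul1r dK.
rewrite Kmax f1 f2.
set m := #|_|%:R => mE; apply/eqP; rewrite -subr_eq0.
have b10 : 1 + beta != 0 by apply: lt0r_neq0; lra.
apply/eqP; apply: (mulfI (_ : - (1 + beta) / (beta * (beta - alpha)) != 0)).
  by rewrite !mulf_neq0 ?invr_neq0 ?oppr_eq0 ?mulf_neq0.
rewrite mulr0 -[RHS]mE; field.
by rewrite ba bn.
Qed.

End Cliques.

(** The second largest eigenvalue bounds the eigenvalues of a local graph other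
    than its valency by [- 1 - b] from below. *)
Lemma local_form_ge0 x (v : T -> R) :
  (forall y, ~~ e x y -> v y = 0) -> \sum_y v y = 0 ->
  0 <= (1 + B) * \sum_y v y ^+ 2 + \sum_y \sum_(z | e y z) v y * v z.
Proof.
move=> vloc vsum.
have D1 : (1 <= D)%N by lia.
have [f ft f0] := exists_cosines D1.
have [f1E f2E] := cosine_values ft f0.
have th1 : theta 1 = n * (beta - alpha) - 1.
  have q1 : qn 1 = 1 by rewrite qnumS // qnum0 mulr0 addr0.
  by rewrite /classical_eigenvalue subn1 q1 mulr1.
rewrite tight_valency tight_b1 (tight_a1 b_ge2 cl tig) th1 in f1E f2E.
have b0 := beta_gt0.
have k_gt0 : 0 < (1 + B * n) * beta by rewrite mulr_gt0 ?qD_gt0.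
have k0 := lt0r_neq0 k_gt0.
have B_gt0 : 0 < B by have := B_ge2; lra.
have ab : 0 < beta - alpha by rewrite subr_gt0 (alpha_lt_beta b_ge2 cl).
have b1_neq0 : B * n * (beta - alpha) != 0 by rewrite lt0r_neq0 // mulr_gt0 ?Bn_gt0.
pose g := (1 + B * n) * beta - (n * (beta - alpha) - 1).
have g_gt0 : 0 < g.
  rewrite (_ : g = 1 + beta + n * ((B - 1) * beta + alpha)); last by rewrite /g; ring.
  have B1 : 0 < B - 1 by have := B_ge2; lra.
  by rewrite !addr_gt0 // mulr_gt0 ?addr_gt0 ?mulr_gt0 //; have := n_ge2; lra.
have {}f1E : f 1%N = 1 - g / ((1 + B * n) * beta).
  apply: (mulfI k0); rewrite f1E /g; field.
  by rewrite !lt0r_neq0 ?qD_gt0.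
(* The next two facts say that the cosines of this eigenvalue satisfy
   [1 - f 2 = (1 + b) (f 1 - f 2)], so on local vectors with sum zero the form
   is [f 1 - f 2] times the one of the statement. *)
have f12E : f 1%N - f 2%N = g / ((1 + B * n) * beta) / B.
  apply: (mulfI b1_neq0); rewrite mulrBr.
  have -> : B * n * (beta - alpha) * f 2%N = (n * (beta - alpha) - 1) * f 1%N
      - (1 + alpha * n * (1 + B) * f 1%N) by rewrite -f2E; ring.
  rewrite f1E /g; move: k0; rewrite betaE mulf_eq0 negb_or => /andP[qD0 b0'].
  by field; rewrite b0' qD0 lt0r_neq0.
have f12 : 1 - f 2%N = (1 + B) * (f 1%N - f 2%N).
  have -> : 1 - f 2%N = (1 - f 1%N) + (f 1%N - f 2%N) by ring.
  rewrite f12E f1E; field.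
  by rewrite !lt0r_neq0 ?qD_gt0.
have f12_gt0 : 0 < f 1%N - f 2%N by rewrite f12E !divr_gt0.
rewrite -(pmulr_rge0 _ f12_gt0).
have := distance_eigenfunction_ge0 drg Dgt0 v ft f0.
rewrite [X in 0 <= X -> _](_ : _ = (f 1%N - f 2%N) *
  ((1 + B) * (\sum_y v y ^+ 2) + \sum_y \sum_(z | e y z) v y * v z)) //.
transitivity (\sum_y \sum_z (v y * v z * f 2%N
  + (if z == y then v y * v z * (1 - f 2%N) else 0)
  + (if e y z then v y * v z * (f 1%N - f 2%N) else 0))).
  apply: eq_bigr => y _; apply: eq_bigr => z _.
  have [exy|/vloc->] := boolP (e x y); last by rewrite !mul0r !if_same !addr0.
  have [exz|/vloc->] := boolP (e x z); last by rewrite mulr0 !mul0r !if_same !addr0.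
  case: eqVneq => [->|zy]; first by rewrite distxx f0 eirr; ring.
  have [eyz|nyz] := boolP (e y z).
    by have /eqP -> : dist e y z == 1%N; [rewrite dist_eq1|ring].
  by rewrite (dist_eq2 esym eirr econ exy exz) 1?eq_sym // !addr0.
under eq_bigr do rewrite !big_split.
rewrite !big_split /=.
have -> : \sum_y \sum_z v y * v z * f 2%N = 0.
  rewrite big1 // => y _; rewrite -mulr_suml -mulr_sumr vsum; ring.
rewrite add0r mulrDr mulrA -[_ * (1 + B)]mulrC -f12; congr (_ + _).
  rewrite mulr_sumr; apply: eq_bigr => y _.
  by rewrite -big_mkcond big_pred1_eq; ring.
rewrite mulr_sumr; apply: eq_bigr => y _.
by rewrite -big_mkcond mulr_sumr; apply: eq_bigr => z _; ring.
Qed.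

End TightGraph.

(** * Partial geometries *)

(** In the usual notation this is a pg(l - 1, p - 1, tau) with collinearity
    relation [adj].  The lines form an arbitrary type, so that the pairs of a
    row and a symbol of an array, and the points of a design, can both serve. *)
Definition partial_geometry (P L : finType) (adj : rel P) (inc : P -> L -> bool)
    (p l tau : nat) : Prop :=
  [/\ irreflexive adj,
      forall y, #|[set k | inc y k]| = p,
      forall k, #|[set y | inc y k]| = l,
      forall y z, y != z -> #|[set k | inc y k && inc z k]| = adj y z
    & forall y k, ~~ inc y k -> #|[set z | inc z k && adj y z]| = tau].

Lemma double_count (X Y : finType) (r : X -> Y -> bool) (Q : pred X) (S : pred Y) :
  (\sum_(x | Q x) #|[set y | S y && r x y]|
    = \sum_(y | S y) #|[set x | Q x && r x y]|)%N.
Proof.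
under eq_bigr do rewrite -sum1dep_card.
under [RHS]eq_bigr do rewrite -sum1dep_card.
rewrite (exchange_big_dep S) /=; last by move=> x y _ /andP[].
by apply: eq_bigr => y Sy; apply: eq_bigl => x; rewrite Sy.
Qed.

Lemma card_sig_set (X : finType) (Q A : pred X) :
  #|[set y : {y | Q y} | A (val y)]| = #|[set y | Q y & A y]|.
Proof.
rewrite -(card_imset _ val_inj); apply: eq_card => y.
apply/imsetP/idP => [[z]|]; rewrite !inE.
  by move=> Az ->; rewrite (valP z).
by case/andP=> Qy Ay; exists (exist _ y Qy); rewrite ?inE.
Qed.

Arguments card_sig_set {X} Q A.

Section PartialGeometry.
Variables (P L : finType) (adj : rel P) (inc : P -> L -> bool) (p l tau : nat).
Hypothesis pg : partial_geometry adj inc p l tau.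
Implicit Types (y z w u v : P) (k m : L).

Let adjxx : irreflexive adj. Proof. by case: pg. Qed.
Let lines_on y : #|[set k | inc y k]| = p. Proof. by case: pg. Qed.
Let points_on k : #|[set y | inc y k]| = l. Proof. by case: pg. Qed.
Let common_lines y z : y != z -> #|[set k | inc y k && inc z k]| = adj y z.
Proof. by case: pg => _ _ _ + _; apply. Qed.
Let collinear_on y k : ~~ inc y k -> #|[set z | inc z k && adj y z]| = tau.
Proof. by case: pg => _ _ _ _; apply. Qed.

Let card_inc y : #|inc y| = p.
Proof. by rewrite -(lines_on y); apply: eq_card => k; rewrite !inE. Qed.

Lemma pg_adjC : symmetric adj.
Proof.
move=> y z; have [->//|yz] := eqVneq y z.
have := common_lines yz; rewrite eq_sym in yz; have := common_lines yz.
rewrite (_ : [set k | inc z k && inc y k] = [set k | inc y k && inc z k]).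
  by move=> ->; case: (adj y z); case: (adj z y).
by apply/setP => k; rewrite !inE andbC.
Qed.

Lemma pg_adjP y z : y != z -> reflect (exists2 k, inc y k & inc z k) (adj y z).
Proof.
move=> yz; apply: (iffP idP) => [yz_adj|[k yk zk]].
  have : (0 < #|[set k | inc y k && inc z k]|)%N by rewrite common_lines // yz_adj.
  by case/card_gt0P => k; rewrite inE => /andP[]; exists k.
have : (0 < #|[set k | inc y k && inc z k]|)%N.
  by apply/card_gt0P; exists k; rewrite inE yk.
by rewrite common_lines //; case: adj.
Qed.

Lemma pg_line_uniq y z k m :
  y != z -> inc y k -> inc z k -> inc y m -> inc z m -> k = m.
Proof.
move=> yz yk zk ym zm; apply/eqP; apply: contraT => km.
have : (#|[set k; m]| <= #|[set k | inc y k && inc z k]|)%N.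
  by apply/subset_leq_card/subsetP => h; rewrite !inE => /orP[]/eqP->; apply/andP.
by rewrite cards2 km common_lines //; case: adj.
Qed.

Lemma pg_degree y : #|[set z | adj y z]| = (p * l.-1)%N.
Proof.
have := double_count (fun z k => inc z k) (fun z => z != y) (fun k => inc y k).
rewrite (eq_bigr (fun z => adj y z : nat)) => [|z zy]; last first.
  by rewrite common_lines // eq_sym.
rewrite [RHS](eq_bigr (fun=> l.-1)) => [|k yk].
  rewrite sum_nat_const card_inc => <-.
  rewrite -sum1dep_card big_mkcond [RHS]big_mkcond; apply: eq_bigr => z _.
  by case: eqVneq => [->|_]; rewrite ?adjxx //; case: adj.
rewrite -(points_on k) (cardsD1 y [set z | inc z k]) inE yk; apply: eq_card => z.
by rewrite !inE.
Qed.

(** Each of the [p] lines on [z] carries [tau] neighbours of [y]. *)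
Lemma pg_common_neighbours y z : y != z -> ~~ adj y z ->
  #|[set w | adj y w && adj z w]| = (p * tau)%N.
Proof.
move=> yz nyz.
have := double_count (fun w k => inc w k) (fun w => adj y w) (fun k => inc z k).
rewrite (eq_bigr (fun w => adj z w : nat)) => [|w yw]; last first.
  by rewrite common_lines //; apply: contraTneq yw => <-.
rewrite [RHS](eq_bigr (fun=> tau)) => [|k zk].
  rewrite sum_nat_const card_inc => <-.
  rewrite -sum1dep_card big_mkcondr; apply: eq_bigr => w _.
  by case: adj.
rewrite -(@collinear_on y k).
  by apply: eq_card => w; rewrite !inE andbC.
by apply: contra nyz => yk; apply/pg_adjP => //; exists k.
Qed.

Lemma pg_line_neighbours y k : inc y k ->
  #|[set z | inc z k && adj y z]| = l.-1.
Proof.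
move=> yk; rewrite -(points_on k) (cardsD1 y [set z | inc z k]) inE yk.
apply: eq_card => z; rewrite !inE.
case: eqVneq => [->|zy]; first by rewrite adjxx andbF.
case zk: (inc z k) => //=.
by apply/pg_adjP; [rewrite eq_sym|exists k].
Qed.

(** Count the collinear pairs formed by a point of [k] and a point off [k]. *)
Lemma pg_card k : ((#|P| - l) * tau = l * (p.-1 * l.-1))%N.
Proof.
have := double_count (fun z y => adj z y) (fun z => inc z k) (fun y => ~~ inc y k).
rewrite (eq_bigr (fun=> (p.-1 * l.-1)%N)) => [|z zk].
  rewrite [RHS](eq_bigr (fun=> tau)) => [|y yk].
    rewrite !sum_nat_const -[#|_|](cardsE (fun z => inc z k)) points_on => ->.
    congr (_ * _)%N; rewrite -(points_on k) -cardsT -cardsDS ?subsetT //.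
    by rewrite -[LHS]cardsE; apply: eq_card => y; rewrite !inE andbT.
  by rewrite -(collinear_on yk); apply: eq_card => z; rewrite !inE pg_adjC.
have onk : #|[set y | adj z y] :&: [set y | inc y k]| = l.-1.
  by rewrite -(pg_line_neighbours zk); apply: eq_card => y; rewrite !inE andbC.
have := cardsID [set y | inc y k] [set y | adj z y]; rewrite onk pg_degree.
rewrite -[p.-1]subn1 mulnBl mul1n => <-; rewrite addKn; apply: eq_card => y.
by rewrite !inE andbC.
Qed.

(** [M] behaves like the point set of a subgeometry with lines of size
    [tau + 1]. *)
Section Subgeometry.
Variable M : {set P}.
Hypothesis cardM : #|M| = (p * tau.+1)%N.
Hypothesis lineM : forall y k, y \in M -> inc y k ->
  #|[set z in M | inc z k]| = tau.+1.

Let meets k := [exists y, (y \in M) && inc y k].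

Let card_meets : #|[set k | meets k]| = (p * p)%N.
Proof.
apply/eqP; rewrite -(@eqn_pmul2r tau.+1) // -mulnA (mulnC p tau.+1) mulnA -cardM.
apply/eqP; have := double_count inc (fun y => y \in M) meets.
rewrite (eq_bigr (fun=> p)) => [|y yM].
  rewrite [RHS](eq_bigr (fun=> tau.+1)) => [|k /existsP[y /andP[yM yk]]].
    by rewrite !sum_nat_const cardsE => ->.
  exact: (lineM yM yk).
rewrite -(lines_on y); apply: eq_card => k; rewrite !inE.
by case yk: (inc y k); rewrite ?andbF // andbT; apply/existsP; exists y; rewrite yM.
Qed.

Let degM t : t \in M -> #|[set s in M | adj t s]| = (p * tau)%N.
Proof.
move=> tM.
have := double_count inc (fun s => (s \in M) && (s != t)) (fun k => inc t k).
rewrite (eq_bigr (fun s => adj t s : nat)) => [|s /andP[_ st]]; last first.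
  by rewrite common_lines // eq_sym.
rewrite [RHS](eq_bigr (fun=> tau)) => [|k tk].
  rewrite sum_nat_const card_inc => <-.
  rewrite -sum1dep_card big_mkcond [RHS]big_mkcond; apply: eq_bigr => s _.
  have [->|_] := eqVneq s t; first by rewrite adjxx !andbF.
  by case: (s \in M); case: (adj t s).
apply: succn_inj; rewrite -(lineM tM tk) [RHS](cardsD1 t) !inE tM tk add1n.
by congr _.+1; apply: eq_card => s; rewrite !inE andbA [(_ != _) && _]andbC.
Qed.

(** Each point [t] of [M] has [p * tau] neighbours in [M], each on [p - 1] of
    the [p * p - p] lines that meet [M] and avoid [t]; on average these lines
    carry [tau] of them, which is also the maximum. *)
Lemma pg_sub_closed t s k :
  t \in M -> meets k -> ~~ inc t k -> inc s k -> adj t s -> s \in M.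
Proof.
move=> tM mk tk sk ts.
pose away h := meets h && ~~ inc t h.
pose part h := [set r | ((r \in M) && adj t r) && inc r h].
pose full h := [set r | inc r h && adj t r].
have sub h : part h \subset full h.
  by apply/subsetP => r; rewrite !inE => /andP[/andP[_ ->] ->].
have card_full h : away h -> #|full h| = tau by case/andP => _ /collinear_on.
have card_away : #|[set h | away h]| = (p * p - p)%N.
  rewrite -card_meets -[X in (_ - X)%N](lines_on t).
  have := cardsID [set h | inc t h] [set h | meets h].
  have -> : [set h | meets h] :&: [set h | inc t h] = [set h | inc t h].
    apply/setP => h; rewrite !inE; case th: (inc t h); rewrite ?andbF // andbT.
    by apply/existsP; exists t; rewrite tM.
  move=> <-; rewrite addKn; apply: eq_card => h.
  by rewrite !inE andbC.
have sum_part : (\sum_(h | away h) #|part h| = \sum_(h | away h) #|full h|)%N.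
  rewrite [RHS](eq_bigr (fun=> tau)) // sum_nat_const -[#|_|]cardsE card_away.
  rewrite -(double_count inc (fun r => (r \in M) && adj t r) away).
  rewrite (eq_bigr (fun=> p.-1)) => [|r /andP[rM tr]].
    rewrite sum_nat_const -[#|_|]cardsE degM // -subn1; nia.
  have tr' : t != r by apply: contraTneq tr => ->; rewrite adjxx.
  have := cardsID [set h | inc t h] [set h | inc r h]; rewrite lines_on.
  have -> : [set h | inc r h] :&: [set h | inc t h] = [set h | inc t h && inc r h].
    by apply/setP => h; rewrite !inE andbC.
  rewrite common_lines // tr => <-; rewrite add1n /=; apply: eq_card => h.
  rewrite !inE /away; case rh: (inc r h); rewrite ?andbF // !andbT.
  suff -> : meets h by [].
  by apply/existsP; exists r; rewrite rM.
have eq_part h : away h -> part h = full h.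
  move=> ah; apply/eqP; rewrite eqEcard sub /=.
  have := leqif_sum (fun h (_ : away h) => leqif_geq (subset_leq_card (sub h))).
  by move=> -[_]; rewrite sum_part eqxx => /esym/forall_inP/(_ h ah).
have : s \in full k by rewrite inE sk.
by rewrite -eq_part ?inE ?/away ?mk // => /andP[/andP[]].
Qed.

(** Hence a line of [M] on [w] but not on [u] consists, inside [M], of [w] and
    the [tau] neighbours of [u]. *)
Lemma pg_sub_nonadjacent u w v : u \in M -> w \in M -> v \in M ->
  u != w -> ~~ adj u w -> adj w v -> adj u v.
Proof.
move=> uM wM vM uw nuw wv.
have w_v : w != v by apply: contraTneq wv => ->; rewrite adjxx.
have /(pg_adjP w_v)[k wk vk] := wv.
have uk : ~~ inc u k by apply: contra nuw => uk; apply/pg_adjP => //; exists k.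
have mk : meets k by apply/existsP; exists w; rewrite wM.
have sub : w |: [set z | inc z k && adj u z] \subset [set z in M | inc z k].
  apply/subsetP => z; rewrite !inE => /orP[/eqP->|/andP[zk uz]].
    by rewrite wM.
  by rewrite zk (pg_sub_closed uM mk uk zk uz).
have /eqP : w |: [set z | inc z k && adj u z] == [set z in M | inc z k].
  rewrite eqEcard sub (lineM wM wk) cardsU1 collinear_on // !inE.
  by rewrite (negPf nuw) andbF /= add1n.
move=> /setP/(_ v); rewrite !inE vM vk (eq_sym v) (negPf w_v) /=.
by move=> ->.
Qed.

End Subgeometry.

(** Fix [w], lines [k] and [m] meeting in a neighbour [y] of [w], and a further
    neighbour [v] of [w] on [m].  For each [u] on [k] not adjacent to [w], a
    subgeometry on [u] and [w] contains [y], then [v]; so [v] is adjacent to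
    every such [u], and to [y]. *)
Lemma pg_no_subgeometries : (0 < #|P|)%N -> (3 <= p)%N -> (2 <= tau)%N ->
  (2 * tau <= l)%N ->
  ~ (forall u w, u != w -> ~~ adj u w -> exists M : {set P},
      [/\ u \in M, w \in M, #|M| = (p * tau.+1)%N
        & forall y k, y \in M -> inc y k -> #|[set z in M | inc z k]| = tau.+1]).
Proof.
case/card_gt0P => w _ p3 tau2 tau_l subs.
have : (0 < #|[set k | inc w k]|)%N by rewrite lines_on; lia.
case/card_gt0P => h; rewrite inE => wh.
have : (0 < #|[set y | inc y h] :\ w|)%N.
  by have := cardsD1 w [set y | inc y h]; rewrite points_on inE wh; lia.
case/card_gt0P => y; rewrite !inE => /andP[yw yh].
have : (1 < #|[set k | inc y k] :\ h|)%N.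
  by have := cardsD1 h [set k | inc y k]; rewrite lines_on inE yh; lia.
case/card_gt1P => k [m [+ + km]]; rewrite !inE => /andP[kh yk] /andP[mh ym].
have off g : g != h -> inc y g -> ~~ inc w g.
  by move=> gh yg; apply: contra gh => wg; apply/eqP; apply: (pg_line_uniq yw).
have wy : adj w y by apply/pg_adjP; [rewrite eq_sym|exists h].
have : (0 < #|[set z | inc z m && adj w z] :\ y|)%N.
  have := cardsD1 y [set z | inc z m && adj w z].
  by rewrite collinear_on ?(off m mh ym) // inE ym wy; move: tau2; clear; lia.
case/card_gt0P => v; rewrite !inE => /and3P[vy vm wv].
have vk : ~~ inc v k.
  by apply: contra km => vk; apply/eqP; apply: (pg_line_uniq vy).
have vu u : inc u k -> ~~ adj w u -> adj v u.
  move=> uk wu.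
  have w_u : u != w by apply: contraTneq uk => ->; apply: off.
  have [|M [uM wM cM lM]] := subs u w w_u; first by rewrite pg_adjC.
  have yM : y \in M.
    apply: (pg_sub_closed cM lM wM _ (off k kh yk) yk wy).
    by apply/existsP; exists u; rewrite uM.
  have vM : v \in M.
    apply: (pg_sub_closed cM lM wM _ (off m mh ym) vm wv).
    by apply/existsP; exists y; rewrite yM.
  by rewrite pg_adjC (pg_sub_nonadjacent cM lM uM wM vM) // pg_adjC.
have : (#|y |: ([set u | inc u k] :\: [set u | adj w u])| <= tau)%N.
  rewrite -(collinear_on vk); apply/subset_leq_card/subsetP => u; rewrite !inE.
  case/orP => [/eqP->|/andP[wu uk]]; last by rewrite uk vu.
  by rewrite yk; apply/pg_adjP => //; exists m.
rewrite cardsU1 !inE wy cardsD points_on /= add1n.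
have -> : [set u | inc u k] :&: [set u | adj w u] = [set u | inc u k && adj w u].
  by apply/setP => u; rewrite !inE.
rewrite collinear_on ?(off k kh yk) //.
by move: tau2 tau_l; clear; lia.
Qed.

End PartialGeometry.

Lemma pg_isomorphic (P Q L : finType) (adj : rel P) (adj' : rel Q)
    (inc : Q -> L -> bool) (p l tau : nat) (g : P -> Q) :
  bijective g -> (forall y z, adj' (g y) (g z) = adj y z) ->
  partial_geometry adj' inc p l tau ->
  partial_geometry adj (fun y k => inc (g y) k) p l tau.
Proof.
move=> gbij gadj [irr lines points common coll].
have ginj := bij_inj gbij.
have card_pre (A : pred Q) : #|[set y | A (g y)]| = #|[set z | A z]|.
  rewrite -(on_card_preimset (f := g)); last exact: onW_bij.
  by apply: eq_card => y; rewrite !inE.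
split=> [y|y|k|y z yz|y k yk].
- by rewrite -gadj irr.
- exact: lines.
- by rewrite (card_pre (fun z => inc z k)) points.
- by rewrite common ?gadj // (inj_eq ginj).
rewrite -(coll _ _ yk) -(card_pre (fun z => inc z k && adj' (g y) z)).
by apply: eq_card => z; rewrite !inE gadj.
Qed.

(** The vector is constant on [y], on the neighbours of [y] and on the other
    points, with values chosen so that the sum over each line vanishes; it is
    thus an eigenvector of [adj] for [- p]. *)
Lemma pg_eigenvector (R : realDomainType) (P L : finType) (adj : rel P)
    (inc : P -> L -> bool) (p l tau : nat) y z :
  partial_geometry adj inc p l tau -> y != z -> ~~ adj y z ->
  (0 < p)%N -> (0 < tau)%N ->
  exists v : P -> R, [/\ 0 < \sum_u v u ^+ 2, \sum_u v u = 0
    & \sum_u \sum_(w | adj u w) v u * v w = - p%:R * \sum_u v u ^+ 2].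
Proof.
move=> pg yz nyz p0 tau0.
have [irr lines points common coll] := pg.
pose c : R := tau%:R - (l%:R - 1) * (l%:R - tau%:R).
pose v u : R := c * (u == y)%:R + l%:R * (adj y u)%:R - tau%:R.
have line_sum k : \sum_(u | inc u k) v u = 0.
  have card_line : \sum_(u | inc u k) tau%:R = l%:R * tau%:R :> R.
    by rewrite -(points k) sumr_const mulr_natl; congr (_ *+ _); rewrite cardsE.
  have sum_adj : \sum_(u | inc u k) (adj y u)%:R
      = #|[set u | inc u k && adj y u]|%:R :> R.
    by rewrite -natr_sum -sum1dep_card big_mkcondr; congr _%:R.
  rewrite sumrB big_split /= -!mulr_sumr card_line sum_adj.
  case yk: (inc y k); last first.
    rewrite coll ?yk // big1 ?mulr0 ?add0r ?subrr // => u uk.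
    by case: eqVneq uk => // ->; rewrite yk.
  rewrite (bigD1 y) //= eqxx big1 ?addr0 => [|u /andP[_ /negPf->]//].
  rewrite (pg_line_neighbours pg yk) /c.
  have l0 : (0 < l)%N by rewrite -(points k); apply/card_gt0P; exists y; rewrite inE.
  have -> : l%:R = l.-1%:R + 1 :> R by rewrite natr1 prednK.
  by rewrite mulr1; ring.
have vz : v z = - tau%:R.
  by rewrite /v (negPf nyz) eq_sym (negPf yz) !mulr0 !add0r.
exists v; split.
- rewrite (bigD1 z) //= vz ltr_pwDl //.
    by rewrite sqrrN exprn_gt0 // ltr0n.
  by apply: sumr_ge0 => u _; apply: sqr_ge0.
- have : p%:R * \sum_u v u = 0.
    transitivity (\sum_k \sum_(u | inc u k) v u); last by rewrite big1.
    rewrite mulr_sumr.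
    rewrite (exchange_big_dep xpredT) //=; apply: eq_bigr => u _.
    rewrite sumr_const mulr_natl -(lines u); congr (_ *+ _).
    by apply: eq_card => k; rewrite inE.
  by move/eqP; rewrite mulf_eq0 pnatr_eq0 gtn_eqF //= => /eqP.
have : \sum_k \sum_(u | inc u k) \sum_(w | inc w k) v u * v w = 0.
  rewrite big1 // => k _.
  transitivity ((\sum_(u | inc u k) v u) * (\sum_(w | inc w k) v w)).
    by rewrite mulr_suml; apply: eq_bigr => u _; rewrite mulr_sumr.
  by rewrite line_sum mul0r.
rewrite (exchange_big_dep xpredT) //=.
move=> E; apply/eqP; rewrite mulNr -addr_eq0; apply/eqP.
rewrite -[RHS]E mulr_sumr -big_split /=.
apply: eq_bigr => u _.
rewrite (exchange_big_dep xpredT) //= [RHS](bigD1 u) //= [RHS]addrC.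
congr (_ + _); last first.
  rewrite sumr_const mulr_natl -(lines u) -expr2; congr (_ *+ _).
  by apply: eq_card => k; rewrite inE unfold_in andbb.
rewrite big_mkcond [RHS]big_mkcond; apply: eq_bigr => w _.
case: eqVneq => [->|wu] /=; first by rewrite irr.
rewrite sumr_const (_ : #|_| = adj u w); first by case: (adj u w).
by rewrite -common 1?eq_sym //; apply: eq_card => k; rewrite inE unfold_in.
Qed.

(** * Local graphs of tight graphs *)

Section LocalGraph.
Variables (R : rcfType) (T : finType) (e : rel T).
Variables (D : nat) (b : int) (alpha beta : R).
Hypothesis b_ge2 : (2 : int) <= b.
Hypothesis cl : classical_parameters e D b alpha beta.
Hypothesis tig : tight R e.
Variable x : T.

Local Notation B := (b%:~R : R).
Local Notation n := (qnum R b D.-1).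
Local Notation P := {y : T | e x y}.
Local Notation adj := (local_graph e x).

Let drg : distance_regular e. Proof. by case: cl. Qed.
Let esym : symmetric e. Proof. by case: drg => -[]. Qed.
Let eirr : irreflexive e. Proof. by case: drg => -[]. Qed.
Let econ : connected_graph e. Proof. by case: drg. Qed.
Let diamD : diameter e = D. Proof. by case: cl => _ []. Qed.
Let D_ge3 : (3 <= D)%N. Proof. by case: cl => _ []. Qed.
Let Dgt0 : (0 < diameter e)%N. Proof. by rewrite diamD; lia. Qed.

Let B_ge2 : 2 <= B. Proof. exact: base_ge2. Qed.
Let n_ge2 : 2 <= n. Proof. exact: (qnum_pred_ge2 b_ge2 cl). Qed.
Let alpha_gt0 : 0 < alpha. Proof. exact: (tight_alpha_gt0 b_ge2 cl tig). Qed.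
Let betaE : beta = 1 + alpha * n. Proof. exact: (tight_beta b_ge2 cl tig). Qed.

Lemma local_card : #|{: P}| = valency e.
Proof.
rewrite -cardsT (card_sig_set (e x) xpredT) /valency /drg_b.
rewrite -(card_nbrs drg Dgt0 1 (distxx e x)).
by apply: eq_card => y; rewrite !inE dist_eq1 // andbb andbT.
Qed.

Lemma local_degree (y : P) : #|[set z | adj y z]| = drg_a e 1.
Proof.
have dxy : dist e x (val y) = 1%N by apply/eqP; rewrite dist_eq1 ?(valP y).
rewrite (card_sig_set (e x) (e (val y))) /drg_a -(card_nbrs drg Dgt0 1 dxy).
by apply: eq_card => z; rewrite !inE dist_eq1 // andbC.
Qed.

Lemma local_nonadjacent (y : P) : exists2 z, y != z & ~~ adj y z.
Proof.
have : (0 < #|~: (y |: [set z | adj y z])|)%N.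
  rewrite cardsCs setCK subn_gt0 local_card cardsU1 inE local_degree.
  have dxy : dist e x (val y) = 1%N by apply/eqP; rewrite dist_eq1 ?(valP y).
  have c1 : drg_c e 1 = 1%N.
    apply/eqP; rewrite -(eqr_nat R) (classical_c b_ge2 cl); last by lia.
    by rewrite qnumS // qnum0; apply/eqP; ring.
  have b1 : (0 < drg_b e 1)%N by apply: drg_b_gt0 => //; lia.
  by rewrite -(drg_abc R drg Dgt0 dxy) c1 /local_graph eirr /=; move: b1; clear; lia.
case/card_gt0P => z; rewrite !inE negb_or eq_sym => /andP[yz nyz].
by exists z.
Qed.

Lemma card_cone (A : {set P}) : #|x |: val @: A| = (1 + #|A|)%N.
Proof.
rewrite cardsU1 card_imset; last exact: val_inj.
suff -> : x \notin val @: A by [].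
by apply/imsetP => -[y _ xy]; have := valP y; rewrite -xy eirr.
Qed.

Lemma cone_clique (A : {set P}) :
  {in A &, forall y z, y != z -> adj y z} ->
  {in x |: val @: A &, forall y z, y != z -> e y z}.
Proof.
move=> cliqueA y z; rewrite !inE.
case/predU1P => [->|/imsetP[y' y'A ->]]; case/predU1P => [->|/imsetP[z' z'A ->]].
- by rewrite eqxx.
- by move=> _; apply: (valP z').
- by move=> _; rewrite esym; apply: (valP y').
by rewrite (inj_eq val_inj) => /cliqueA; apply.
Qed.

Lemma local_clique_card_le (A : {set P}) :
  {in A &, forall y z, y != z -> adj y z} -> #|A|%:R <= beta.
Proof.
move=> cliqueA.
have := clique_card_le b_ge2 cl tig (cone_clique cliqueA).
by rewrite card_cone natrD lerD2l.
Qed.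
(** A disjoint union of cliques would have cliques of size
    [a_1 + 1 = 1 + alpha n (1 + b)], above the bound [beta = 1 + alpha n]. *)
Lemma local_not_cluster :
  ~ (forall u v w : P, adj u v -> adj v w -> u != w -> adj u w).
Proof.
move=> tr.
have /card_gt0P[y _] : (0 < #|{: P}|)%N.
  by rewrite local_card; apply: drg_b_gt0.
have adjC (u v : P) : adj u v = adj v u by exact: esym.
have : #|y |: [set z | adj y z]|%:R <= beta.
  apply: local_clique_card_le => u v; rewrite !inE.
  case/predU1P => [->|yu]; case/predU1P => [->|yv] uv //.
  - by rewrite eqxx in uv.
  - by rewrite adjC.
  by apply: (tr u y v) => //; rewrite adjC.
rewrite cardsU1 inE /local_graph eirr local_degree natrD (tight_a1 b_ge2 cl tig).
have : 0 < alpha * n by rewrite mulr_gt0 //; have := n_ge2; lra.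
by rewrite betaE /=; move: (alpha * n) B_ge2 => t; nra.
Qed.

Section Geometry.
Variables (L : finType) (inc : P -> L -> bool) (p l tau : nat).
Hypothesis pg : partial_geometry adj inc p l tau.
Hypotheses (p_gt1 : (1 < p)%N) (p_tau : (p <= tau.+1)%N).

Let tau_gt0 : (0 < tau)%N. Proof. by lia. Qed.

Let line_clique k : {in [set y | inc y k] &, forall y z, y != z -> adj y z}.
Proof.
move=> y z; rewrite !inE => yk zk yz.
by apply/(pg_adjP pg yz); exists k.
Qed.

Let point_exists : exists y : P, true.
Proof.
have /card_gt0P[y _] : (0 < #|{: P}|)%N by rewrite local_card; apply: drg_b_gt0.
by exists y.
Qed.

Let line_exists y : exists k, inc y k.
Proof.
have [_ lines _ _ _] := pg.
have /card_gt0P[k] : (0 < #|[set k | inc y k]|)%N by rewrite lines ltnW.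
by rewrite inE; exists k.
Qed.

Let l_gt0 : (0 < l)%N.
Proof.
have [_ _ points _ _] := pg; have [y _] := point_exists; have [k yk] := line_exists y.
by rewrite -(points k); apply/card_gt0P; exists y; rewrite inE.
Qed.

Let degree_eq : p%:R * (l%:R - 1) = alpha * n * (1 + B) :> R.
Proof.
have [y _] := point_exists.
rewrite -(tight_a1 b_ge2 cl tig) -(local_degree y) (pg_degree pg) natrM.
by rewrite -subn1 natrB.
Qed.

Let line_size_le : l%:R <= beta.
Proof.
have [_ _ points _ _] := pg; have [y _] := point_exists; have [k yk] := line_exists y.
by rewrite -(points k); apply: local_clique_card_le; apply: line_clique.
Qed.

(** [- p] is an eigenvalue of the local graph, so it is at least [- 1 - b]. *)
Let lines_on_le : p%:R <= 1 + B :> R.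
Proof.
have [y _] := point_exists; have [z yz nyz] := local_nonadjacent y.
have [v [vv vsum vadj]] := pg_eigenvector R pg yz nyz (ltnW p_gt1) tau_gt0.
pose v' t := oapp v 0 (insub t : option P).
have v'E (u : P) : v' (val u) = v u by rewrite /v' valK.
have v'0 t : ~~ e x t -> v' t = 0 by move=> xt; rewrite /v' insubN.
have sumE (F : T -> R) : (forall t, ~~ e x t -> F t = 0) ->
    \sum_t F t = \sum_(u : P) F (val u).
  move=> F0; rewrite -(big_sub (e x)) [LHS](bigID (e x)) /=.
  by rewrite [X in _ + X]big1 ?addr0.
have := local_form_ge0 b_ge2 cl tig v'0.
rewrite !sumE //; last 2 first.
- by move=> t xt; rewrite big1 // => u _; rewrite (v'0 _ xt) mul0r.
- by move=> t xt; rewrite (v'0 _ xt) expr0n.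
rewrite (eq_bigr v) // => /(_ vsum).
rewrite (eq_bigr (fun u => v u ^+ 2)) => [|u _]; last by rewrite v'E.
rewrite [X in _ + X](_ : _ = \sum_(u : P) \sum_(w | adj u w) v u * v w).
  by rewrite vadj mulNr -mulrBl pmulr_lge0 // subr_ge0.
apply: eq_bigr => u _.
rewrite big_mkcond sumE => [|t xt]; last by rewrite (v'0 _ xt) mulr0 if_same.
by rewrite [RHS]big_mkcond; apply: eq_bigr => w _; rewrite !v'E.
Qed.

(** Since [p (l - 1) = a_1 = (1 + b) alpha n], the bounds [p <= 1 + b] and
    [l - 1 <= alpha n] are both attained; counting points then gives [tau]. *)
Lemma local_geometry_parameters :
  [/\ p%:R = 1 + B :> R, l%:R = beta & tau%:R = alpha].
Proof.
have an : 0 < alpha * n by rewrite mulr_gt0 //; have := n_ge2; lra.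
have pE : p%:R = 1 + B :> R.
  apply/eqP; rewrite eq_le lines_on_le -(ler_pM2r an) [X in X <= _]mulrC -degree_eq.
  by rewrite ler_wpM2l // lerBlDl -betaE.
have lE : l%:R = beta.
  have B1 : 1 + B != 0 by apply: lt0r_neq0; have := B_ge2; lra.
  have := degree_eq; rewrite pE [RHS]mulrC => /(mulfI B1) /eqP.
  by rewrite subr_eq addrC -betaE => /eqP.
split=> //.
have [y _] := point_exists; have [k _] := line_exists y.
have [_ _ points _ _] := pg.
have : ((#|{: P}| - l) * tau)%:R = (l * (p.-1 * l.-1))%:R :> R by rewrite (pg_card pg k).
have lP : (l <= #|{: P}|)%N by rewrite -(points k) max_card.
have p1E : p.-1%:R = B by rewrite -subn1 natrB ?(ltnW p_gt1) // pE addrC addKr.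
have l1E : l.-1%:R = beta - 1 by rewrite -subn1 natrB // lE.
rewrite !natrM natrB // local_card (tight_valency b_ge2 cl tig) p1E l1E lE => E.
have b0 := beta_gt0 b_ge2 cl tig.
have Bn : beta * (B * n) != 0.
  by rewrite !mulf_neq0 ?lt0r_neq0 //; have := B_ge2; have := n_ge2; lra.
apply: (mulfI Bn); transitivity (((1 + B * n) * beta - beta) * tau%:R); first by ring.
rewrite E betaE; ring.
Qed.

Let common_nbrs y z : dist e y z = 2 -> #|[set t | e y t & e z t]| = (p * tau.+1)%N.
Proof.
have [pE _ tauE] := local_geometry_parameters.
move=> dyz; transitivity (drg_c e 2).
  rewrite /drg_c -(card_nbrs drg Dgt0 1 dyz).
  by apply: eq_card => t; rewrite !inE dist_eq1 // andbC.
apply/eqP; rewrite -(eqr_nat R) natrM -[tau.+1%:R]natr1 pE tauE.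
by rewrite (tight_c2 b_ge2 cl tig) [1 + alpha]addrC.
Qed.

(** Two nonadjacent neighbours of [x] have more common neighbours than lie in
    the local graph, so they lie in the local graph of some [z] at distance two
    from [x]. *)
Let second_vertex (u w : P) : u != w -> ~~ adj u w ->
  exists z, [/\ e z (val u), e z (val w) & dist e x z = 2].
Proof.
move=> uw nuw; pose S := [set t | e (val u) t & e (val w) t].
have cardS : #|S| = (p * tau.+1)%N.
  apply: common_nbrs; apply: (dist_eq2 esym eirr econ (valP u) (valP w)) => //.
have card_in : #|S :&: [set t | e x t]| = (p * tau)%N.
  rewrite -(pg_common_neighbours pg uw nuw).
  rewrite (card_sig_set (e x) (fun t => e (val u) t && e (val w) t)).
  by apply: eq_card => t; rewrite !inE andbC.
have : (0 < #|S :\: [set t | e x t] :\ x|)%N.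
  have := cardsID [set t | e x t] S; rewrite card_in cardS.
  have := cardsD1 x (S :\: [set t | e x t]).
  have : (x \in S :\: [set t | e x t] <= 1)%N by case: (_ \in _).
  by move: p_gt1; clear; nia.
case/card_gt0P => z; rewrite !inE => /and3P[zx xz /andP[uz wz]].
exists z; split; rewrite 1?esym //.
by apply: (dist_eq2 esym eirr econ (x := val u)); rewrite 1?eq_sym // esym (valP u).
Qed.

(** For [z] at distance two from [x], the common neighbours of [x] and [z]
    meet each line [k] in 0 or [tau + 1] points, because [x] and [k] form a
    clique of the maximal size.  So nonadjacent points of the local graph lie in
    common subgeometries, which is impossible for lines of size
    [l = 1 + tau n >= 2 tau]. *)
Lemma local_not_geometry : False.
Proof.
have [pE lE tauE] := local_geometry_parameters.
have [irr lines points common coll] := pg.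
have p3 : (3 <= p)%N by rewrite -(ler_nat R) pE; have := B_ge2; lra.
have tau2 : (2 <= tau)%N by move: p3 p_tau; clear; lia.
have tau_l : (2 * tau <= l)%N.
  rewrite -(ler_nat R) natrM lE betaE -tauE; have := n_ge2.
  have : (0 : R) <= tau%:R by []. by nra.
have [y0 _] := point_exists.
apply: (pg_no_subgeometries pg _ p3 tau2 tau_l).
  by apply/card_gt0P; exists y0.
move=> u w uw nuw; have [z [zu zw dxz]] := second_vertex uw nuw.
have nxz : ~~ e x z by rewrite -(dist_eq1 eirr econ) dxz.
exists [set t : P | e z (val t)]; split; rewrite ?inE //.
  by rewrite (card_sig_set (e x) (e z)) (common_nbrs dxz).
move=> y k; rewrite inE => zy yk.
pose C := x |: val @: [set t | inc t k].
have cardC : #|C|%:R = 1 + beta by rewrite card_cone points natrD lE.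
have cliqueC : {in C &, forall s t, s != t -> e s t}.
  exact: (cone_clique (line_clique (k := k))).
have zC : z \notin C.
  rewrite !inE negb_or; apply/andP; split.
    by apply/eqP => zx; move: dxz; rewrite zx distxx.
  by apply/imsetP => -[t _ zt]; move: nxz; rewrite zt (valP t).
have yC : val y \in C by rewrite !inE imset_f ?orbT // inE.
have zCy : exists2 c, c \in C & e z c by exists (val y).
have := maximal_clique_nbrs b_ge2 cl tig cliqueC cardC zC zCy.
rewrite -tauE [1 + _]addrC natr1 => /eqP; rewrite eqr_nat => /eqP <-.
rewrite -(card_imset _ (@val_inj _ _ P)); apply: eq_card => t.
apply/imsetP/idP => [[s]|]; rewrite !inE.
  by case/andP=> zs sk ->; rewrite zs andbT imset_f ?orbT // inE.
case/andP=> /predU1P[->|/imsetP[s]]; first by rewrite esym (negPf nxz).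
by rewrite inE => sk -> zs; exists s; rewrite ?inE ?zs.
Qed.

End Geometry.
End LocalGraph.

(** * Orthogonal arrays and Steiner systems as partial geometries *)

Section OrthogonalArray.
Variables (p q : nat) (A : 'M['I_q]_(p, q ^ 2)).
Hypothesis oaA : orthogonal_array A.

Let agree c d := [set r | A r c == A r d].

Lemma oa_agree c d : c != d -> #|agree c d| = oa_block_graph A c d.
Proof.
move=> cd; rewrite /oa_block_graph cd /=.
have -> : [exists r, A r c == A r d] = (0 < #|agree c d|)%N.
  apply/existsP/card_gt0P => -[r rcd]; exists r; move: rcd; by rewrite inE.
suff: (#|agree c d| <= 1)%N by case: #|_| => [|[]].
rewrite leqNgt; apply/negP => /card_gt1P[r [s []]]; rewrite !inE => /eqP rcd /eqP scd rs.
have := oaA rs (A r c) (A s c).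
rewrite (cardsD1 c) (cardsD1 d) !inE !eqxx -rcd -scd !eqxx eq_sym cd.
by case.
Qed.

(** The lines are the pairs of a row and a symbol; a column [c] is collinear
    with one column of the line [(r, v)] for each row other than [r]. *)
Lemma oa_partial_geometry : (1 < p)%N ->
  partial_geometry (oa_block_graph A)
    (fun c (k : 'I_p * 'I_q) => A k.1 c == k.2) p q p.-1.
Proof.
move=> p1.
have col_card (Q : pred 'I_p) c :
    #|[set k : 'I_p * 'I_q | Q k.1 && (A k.1 c == k.2)]| = #|[set r | Q r]|.
  rewrite -(card_imset (f := fun r => (r, A r c))) => [|r s [->] //].
  apply: eq_card => -[r v]; apply/idP/imsetP; rewrite inE /=.
    by case/andP=> Qr /eqP <-; exists r; rewrite ?inE.
  by case=> s; rewrite inE => Qs [-> ->]; rewrite Qs eqxx.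
split.
- by move=> c; rewrite /oa_block_graph eqxx.
- move=> c; rewrite (col_card xpredT) -[RHS](card_ord p) -cardsT.
  by apply: eq_card => r; rewrite !inE.
- move=> [r v] /=.
  have [s rs] : exists s, r != s.
    have : (0 < #|[set~ r]|)%N by rewrite cardsC1 card_ord; lia.
    by case/card_gt0P => s; rewrite !inE eq_sym; exists s.
  rewrite -sum1dep_card (partition_big (A s) xpredT) //=.
  under eq_bigr do rewrite sum1dep_card oaA //.
  by rewrite sum1_card card_ord.
- move=> c d cd; rewrite -oa_agree // -(col_card (fun r => A r c == A r d) c).
  apply: eq_card => -[r v]; rewrite !inE /=.
  by case: (A r c =P v) => [->|]; rewrite ?andbF // andbT eq_sym.
move=> c [r v] /= rcv.
have := double_count (fun d s => A s c == A s d) (fun d => A r d == v) (fun s => r != s).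
rewrite (eq_bigr (fun d => oa_block_graph A c d : nat)) => [|d /eqP rdv].
  rewrite [RHS](eq_bigr (fun=> 1%N)) => [|s rs].
    rewrite sum1dep_card => E; rewrite -sum1dep_card big_mkcondr.
    rewrite (eq_bigr (fun d => oa_block_graph A c d : nat)) => [|d _]; last first.
      by case: oa_block_graph.
    rewrite E -[in RHS](card_ord p) -(cardsC1 r); apply: eq_card => s.
    by rewrite !inE eq_sym.
  transitivity #|[set d | (A r d == v) && (A s d == A s c)]|; last exact: oaA.
  by apply: eq_card => d; rewrite !inE [A s c == _]eq_sym.
rewrite -oa_agree; last by apply: contraNneq rcv => ->; rewrite rdv.
apply: eq_card => s; rewrite !inE; case: eqVneq => // <-.
by rewrite rdv (negPf rcv).
Qed.

(** With at most one row, adjacency means equality of the only entry. *)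
Lemma oa_block_graph_cluster c d f : (p <= 1)%N ->
  oa_block_graph A c d -> oa_block_graph A d f -> c != f -> oa_block_graph A c f.
Proof.
move=> p1 /andP[_ /existsP[r /eqP rcd]] /andP[_ /existsP[s /eqP sdf]] cf.
rewrite /oa_block_graph cf; apply/existsP; exists r; rewrite rcd.
suff -> : r = s by rewrite sdf.
by apply/val_inj; have := ltn_ord r; have := ltn_ord s; rewrite /=; lia.
Qed.

End OrthogonalArray.

Section SteinerSystem.
Variables (p q : nat) (S : {set {set 'I_q}}).
Hypothesis steinerS : steiner_system p S.

Let block_card (X : {X | X \in S}) : #|val X| = p.
Proof. by case: steinerS => + _; apply; exact: (valP X). Qed.

Let blocks_on_pair u v : u != v ->
  #|[set X : {X | X \in S} | (u \in val X) && (v \in val X)]| = 1%N.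
Proof.
move=> uv; rewrite (card_sig_set (fun X => X \in S) (fun X => (u \in X) && (v \in X))).
by case: steinerS => _ /(_ u v uv) <-; apply: eq_card => X; rewrite !inE.
Qed.

Let card_meet (X Y : {X | X \in S}) : X != Y ->
  #|[set u | (u \in val X) && (u \in val Y)]| = steiner_block_graph S X Y.
Proof.
move=> XY; rewrite /steiner_block_graph XY /=.
have -> : [set u | (u \in val X) && (u \in val Y)] = val X :&: val Y.
  by apply/setP => u; rewrite !inE.
suff: (#|val X :&: val Y| <= 1)%N by case: #|_| => [|[]].
rewrite leqNgt; apply/negP => /card_gt1P[u [v []]].
rewrite !inE => /andP[uX uY] /andP[vX vY] uv.
have := blocks_on_pair uv.
rewrite (cardsD1 X) (cardsD1 Y) !inE uX vX uY vY eq_sym XY.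
by case.
Qed.

(** The lines are the points of the design, each on [(q - 1) / (p - 1)] blocks; a
    block meets one block of the pencil of a point [u] off it for each of its
    points. *)
Lemma steiner_partial_geometry : (1 < p)%N ->
  partial_geometry (steiner_block_graph S) (fun X u => u \in val X)
    p (q.-1 %/ p.-1) p.
Proof.
move=> p1; split.
- by move=> X; rewrite /steiner_block_graph eqxx.
- by move=> X; rewrite -(block_card X); apply: eq_card => u; rewrite inE.
- move=> u.
  have := double_count (fun w (X : {X | X \in S}) => w \in val X) (fun w => w != u)
    (fun X => u \in val X).
  rewrite (eq_bigr (fun=> 1%N)) => [|w wu]; last by rewrite blocks_on_pair // eq_sym.
  rewrite [RHS](eq_bigr (fun=> p.-1)) => [|X uX]; last first.
    by rewrite -(block_card X) (cardsD1 u (val X)) uX; apply: eq_card => w; rewrite !inE.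
  rewrite !sum_nat_const muln1 => E.
  have -> : q.-1 = (#|[set X : {X | X \in S} | u \in val X]| * p.-1)%N.
    rewrite cardsE -E -[in LHS](card_ord q) -(cardsC1 u).
    by apply: eq_card => w; rewrite !inE.
  by rewrite mulnK //; lia.
- exact: card_meet.
move=> X u uX.
have := double_count (fun (Y : {X | X \in S}) w => w \in val Y) (fun Y => u \in val Y)
  (fun w => w \in val X).
rewrite (eq_bigr (fun Y => steiner_block_graph S X Y : nat)) => [|Y uY]; last first.
  by rewrite card_meet //; apply: contraNneq uX => ->.
rewrite [RHS](eq_bigr (fun=> 1%N)) => [|w wX]; last first.
  by rewrite blocks_on_pair //; apply: contraNneq uX => ->.
rewrite sum1_card block_card => <-; rewrite -sum1dep_card big_mkcondr.
by apply: eq_bigr => Y _; case: steiner_block_graph.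
Qed.

Lemma steiner_block_graph_edgeless X Y : (p <= 1)%N -> ~~ steiner_block_graph S X Y.
Proof.
move=> p1; apply/negP => /andP[/eqP XY /eqP XY1]; apply: XY; apply: val_inj.
have sub (Z : {X | X \in S}) : val X :&: val Y \subset val Z -> val X :&: val Y = val Z.
  by move=> XYZ; apply/eqP; rewrite eqEcard XYZ block_card XY1.
by rewrite -[LHS](sub X) ?subsetIl // (sub Y) ?subsetIr.
Qed.

End SteinerSystem.

Theorem theorem6p3 (R : rcfType) (T : finType) (e : rel T)
    (D : nat) (b : int) (alpha beta : R) :
  (3 <= D)%N -> (2 : int) <= b ->
  tight R e ->
  classical_parameters e D b alpha beta ->
  forall x : T,
    ~ is_oa_block_graph (local_graph e x) /\
    ~ is_steiner_block_graph (local_graph e x).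
Proof.
move=> _ b2 tig cl x; split=> -[p [q [A [designA [g [gbij gadj]]]]]].
  have [p1|p1] := leqP p 1.
    apply: (local_not_cluster b2 cl tig (x := x)) => u v w; rewrite -!gadj => uv vw uw.
    by apply: (oa_block_graph_cluster p1 uv vw); rewrite (bij_eq gbij).
  have pg := pg_isomorphic gbij gadj (oa_partial_geometry designA p1).
  by apply: (local_not_geometry b2 cl tig pg p1); rewrite prednK // ltnW.
have [p1|p1] := leqP p 1.
  apply: (local_not_cluster b2 cl tig (x := x)) => u v w.
  by rewrite -gadj (negPf (steiner_block_graph_edgeless designA _ _ p1)).
have pg := pg_isomorphic gbij gadj (steiner_partial_geometry designA p1).
exact: (local_not_geometry b2 cl tig pg p1).
Qed.
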